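(* Fix $L>4\pi$, and let $k_L$, $c(k)$ and $\phi_k$ be as defined in the context. For each $k\in(0,k_L)$, zero is a simple eigenvalue, with associated eigenfunction $\phi_k'$, of the linearized operator $$\mathcal{L}_k f=-c(k)f''+(c(k)-1)f-\frac32\phi_k^{1/2}f,$$ acting on $L^2_{per}([0,L])$ with domain $H^2_{per}([0,L])$.
   Context: $L^2_{per}([0,L])$ and $H^2_{per}([0,L])$ are the usual $L$-periodic Lebesgue and Sobolev spaces. $K(k)=\int_0^{\pi/2}(1-k^2\sin^2\theta)^{-1/2}d\theta$ is the complete elliptic integral of the first kind and $\mathrm{cn}(\cdot,k)$ is the Jacobi cnoidal elliptic function with modulus $k\in(0,1)$ (parameter $m=k^2$). The function $g(k)=64K^2(k)\sqrt{k^4-k^2+1}$ is strictly increasing on $(0,1)$ with $g(0)=16\pi^2$ and $g(k)\to+\infty$ as $k\to1$; for $L>4\pi$, $k_L\in(0,1)$ denotes the unique number with $g(k_L)=L^2$. For $k\in(0,k_L)$ put $$\tilde m(k)=L^2-64K^2(k)\sqrt{k^4-k^2+1},\qquad c(k)=\frac{L^2}{\tilde m(k)},$$ $$\phi_k(x)=\left[\frac{5}{12}\left(\frac{L^2-64(2k^2-1)K^2(k)}{\tilde m(k)}-1\right)+\frac{80k^2K^2(k)}{\tilde m(k)}\,\mathrm{cn}^2\!\left(\frac{2K(k)}{L}x,k\right)\right]^2 .$$ The expression inside the square brackets is positive, so $\phi_k^{1/2}$ is that expression. Here $\phi_k'$ is the derivative in $x$. *)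

(* Defs.v *)
From HB Require Import structures.
From mathcomp Require Import all_boot all_order all_algebra.
From mathcomp Require Import all_classical all_reals all_analysis.

Set Implicit Arguments.
Unset Strict Implicit.
Unset Printing Implicit Defensive.

Import Order.TTheory GRing.Theory Num.Theory.
Import numFieldNormedType.Exports.

Local Open Scope classical_set_scope.
Local Open Scope ring_scope.

Section elliptic.
Variable R : realType.
Implicit Types k u x L : R.

Definition ellint k (theta : R) : R :=
  (Num.sqrt (1 - k ^+ 2 * sin theta ^+ 2))^-1.

Definition ellK k : R :=
  \int[lebesgue_measure]_(theta in `[0, pi / 2]) ellint k theta.

(* Incomplete integral of the first kind, as the oriented integral from 0 to
   p, so that it is defined (and odd) on the whole line. *)
Definition ellF k (p : R) : R :=
  if 0 <= p then \int[lebesgue_measure]_(theta in `[0, p]) ellint k theta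
  else - \int[lebesgue_measure]_(theta in `[p, 0]) ellint k theta.

(* Jacobi amplitude: for 0 < k < 1, [ellF k] is an increasing bijection of the
   line, so the chosen preimage is the only one. *)
Definition jacobi_am k u : R := get [set p : R | ellF k p = u].

Definition jacobi_cn u k : R := cos (jacobi_am k u).

Definition gK k : R := 64 * ellK k ^+ 2 * Num.sqrt (k ^+ 4 - k ^+ 2 + 1).

Definition mtilde L k : R :=
  L ^+ 2 - 64 * ellK k ^+ 2 * Num.sqrt (k ^+ 4 - k ^+ 2 + 1).

Definition cspeed L k : R := L ^+ 2 / mtilde L k.

Definition phi L k x : R :=
  (5 / 12 * ((L ^+ 2 - 64 * (2 * k ^+ 2 - 1) * ellK k ^+ 2) / mtilde L k - 1)
   + 80 * k ^+ 2 * ellK k ^+ 2 / mtilde L k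
     * jacobi_cn (2 * ellK k / L * x) k ^+ 2) ^+ 2.

End elliptic.

(* Elements of the periodic spaces are represented by real-valued functions
   that are L-periodic on the line, and two representatives are identified
   when they agree almost everywhere on [0, L]. *)
Section periodic_spaces.
Variables (R : realType) (L : R).
Implicit Types f g h eta : R -> R.
Local Notation mu := (@lebesgue_measure R).

Definition ae_eqL f g : Prop := f = g %[ae mu in [set` `[0, L]]].

Definition L2per f : Prop :=
  periodic f L /\ f \_ `[0, L] \in Lfun mu 2%:E.

Definition smooth_per eta : Prop :=
  periodic eta L /\ forall (n : nat) (x : R), derivable (derive1n n eta) x 1.

(* [g] is the derivative of [f] in the sense of periodic distributions. *)
Definition weak_derivative f g : Prop :=
  forall eta, smooth_per eta ->
    \int[mu]_(x in `[0, L]) (f x * derive1 eta x) =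
    - \int[mu]_(x in `[0, L]) (g x * eta x).

Definition H2per_with f f1 f2 : Prop :=
  [/\ L2per f, L2per f1, L2per f2, weak_derivative f f1
    & weak_derivative f1 f2].

(* An unbounded operator on L^2_per is given by its graph: [A f h] means that
   [f] belongs to the domain of [A] and that [A] maps [f] to [h]. *)
Definition operator := (R -> R) -> (R -> R) -> Prop.

Definition eigenfunction (A : operator) (lambda : R) (v : R -> R) : Prop :=
  ~ ae_eqL v (cst 0) /\ A v (fun x => lambda * v x).

(* [f] lies in the kernel of the [n]-th power of [A - lambda]. *)
Fixpoint ker_pow (A : operator) (lambda : R) (n : nat) (f : R -> R) : Prop :=
  if n is m.+1 then
    exists h, A f h /\ ker_pow A lambda m (fun x => h x - lambda * f x)
  else L2per f /\ ae_eqL f (cst 0).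

(* Algebraic multiplicity one: the generalized eigenspace is the line spanned
   by the eigenfunction [v].  In particular the eigenspace (n = 1) is that
   line, which is an equivalent condition when A is self-adjoint. *)
Definition simple_eigenvalue_with (A : operator) (lambda : R) (v : R -> R)
    : Prop :=
  eigenfunction A lambda v /\
  forall (n : nat) f, ker_pow A lambda n f ->
    exists a : R, ae_eqL f (fun x => a * v x).

(* L_k f = - c f'' + (c - 1) f - 3/2 phi^(1/2) f, with domain H^2_per and f''
   the second weak derivative of f. *)
Definition linearized_op (k : R) : operator := fun f h =>
  L2per h /\ exists f1 f2, H2per_with f f1 f2 /\
    ae_eqL h (fun x => - cspeed L k * f2 x + (cspeed L k - 1) * f x
                       - 3 / 2 * Num.sqrt (phi L k x) * f x).

End periodic_spaces.

(* Main.v *)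
Require Import Defs.
From HB Require Import structures.
From mathcomp Require Import all_boot all_order all_algebra ring lra.
From mathcomp Require Import all_classical all_reals all_analysis measurable_realfun.
Set Implicit Arguments.
Unset Strict Implicit.
Unset Printing Implicit Defensive.
Import Order.TTheory GRing.Theory Num.Theory.
Import numFieldNormedType.Exports.
Local Open Scope classical_set_scope.
Local Open Scope ring_scope.

(** Up to a constant, the square root of [phi L k] is the positive periodic
    function [w := profile L k], a solution of the quadratic Newton equation
    [w'' = rate * (12 * w - 6 * w ^+ 2)] with the first integral
    [w' ^+ 2 = - 4 * rate * (w ^+ 3 - 3 * w ^+ 2 + gam)], [0 < gam < 4]
    ([has_deriv_profile'], [profile'_sqr]).  The linearized operator becomes
    [- cspeed L k] times [f'' + rate * (30 * w - 48) * f] ([linearized_opE]), a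
    Lame operator with [n = 5], and the derivative of [phi L k] is a multiple of
    [w * w'], which it annihilates.

    Simplicity amounts to the second solution of this equation not being
    periodic.  That solution is explicit: it is [w * w' * Z] plus a cubic
    polynomial in [w], where [Z] is a primitive of
    [2 * gam + (5 * gam - 24) * w].  Over a period it increases by [Z L] times
    [w * w'], and [Z L] is negative because, up to derivatives of periodic
    functions, the integrand is [- 5 * (w * (w - 2) ^+ 2 + (4 - gam) * w)]
    ([secular_L_neq0]).  By variation of parameters, every smooth periodic
    function orthogonal to [w * w'] is then the image of a smooth periodic
    function ([forced_solution]).

    Elements of the domain are only weakly differentiable, and the argument
    proceeds by duality instead of regularity.  A kernel element is orthogonal
    to the image of all smooth periodic functions, hence to all smooth periodic
    functions orthogonal to [w * w']; so it is a multiple of [w * w'] almost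
    everywhere ([weak_kernel_line], [orthogonal_smooth_per]).  Symmetry excludes
    generalized eigenfunctions ([linearized_op_range]).

    Finally, [mtilde L k] is positive because [gK] is increasing ([gK_lt]).
    With [m := k ^+ 2], the product [ellK k * sqrt (1 - m / 2)] is monotone, as
    one sees by averaging the integrand with its reflection about [pi / 4], and
    [sqrt (k ^+ 4 - k ^+ 2 + 1) / (1 - m / 2)] is increasing. *)

(** * Derivatives and primitives on the line *)

Section calculus.
Context {R : realType}.
Implicit Types f g F G : R -> R.
Notation mu := (@lebesgue_measure R).

Definition has_deriv f g : Prop := forall x : R, is_derive x 1 f (g x).

Lemma has_deriv_eq f g h : has_deriv f g -> g =1 h -> has_deriv f h.
Proof. by move=> fg gh x; apply: is_derive_eq (fg x) (gh x). Qed.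

Lemma has_derivE f g : has_deriv f g -> derive1 f = g.
Proof. by move=> fg; apply/funext => x; rewrite derive1E; apply: derive_val. Qed.

Lemma has_deriv_cst (a : R) : has_deriv (fun=> a) (fun=> 0).
Proof. by move=> x; exact: is_derive_cst. Qed.

Lemma has_deriv_id : has_deriv id (fun=> 1).
Proof. by move=> x; exact: is_derive_id. Qed.

Lemma has_derivD f g f' g' : has_deriv f f' -> has_deriv g g' ->
  has_deriv (fun x => f x + g x) (fun x => f' x + g' x).
Proof. by move=> df dg x; apply: is_deriveD. Qed.

Lemma has_derivN f f' : has_deriv f f' ->
  has_deriv (fun x => - f x) (fun x => - f' x).
Proof. by move=> df x; apply: is_deriveN. Qed.

Lemma has_derivB f g f' g' : has_deriv f f' -> has_deriv g g' ->
  has_deriv (fun x => f x - g x) (fun x => f' x - g' x).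
Proof. by move=> df dg; apply: has_derivD => //; apply: has_derivN. Qed.

Lemma has_derivM f g f' g' : has_deriv f f' -> has_deriv g g' ->
  has_deriv (fun x => f x * g x) (fun x => f' x * g x + f x * g' x).
Proof.
move=> df dg x; apply: is_derive_eq; first exact: is_deriveM.
by rewrite addrC; congr (_ + _); rewrite mulrC.
Qed.

Lemma has_derivZ (a : R) f f' : has_deriv f f' ->
  has_deriv (fun x => a * f x) (fun x => a * f' x).
Proof.
move=> df; apply: has_deriv_eq (has_derivM (has_deriv_cst a) df) _ => x.
by rewrite mul0r add0r.
Qed.

Lemma has_derivX n f f' : has_deriv f f' ->
  has_deriv (fun x => f x ^+ n) (fun x => n%:R * f x ^+ n.-1 * f' x).
Proof.
move=> df; elim: n => [|n IH].
  rewrite (_ : (fun x => f x ^+ 0) = (fun=> 1)).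
    by apply: has_deriv_eq (has_deriv_cst 1) _ => x; rewrite !mul0r.
  by apply/funext => x; rewrite expr0.
rewrite (_ : (fun x => f x ^+ n.+1) = (fun x => f x * f x ^+ n)); last first.
  by apply/funext => x; rewrite exprS.
apply: has_deriv_eq (has_derivM df IH) _.
move=> x /=; case: n {IH} => [|n]; first by rewrite expr0; ring.
by rewrite /= !exprS -[n.+2%:R]natr1; ring.
Qed.

Lemma has_deriv_comp f g f' g' : has_deriv f f' -> has_deriv g g' ->
  has_deriv (fun x => f (g x)) (fun x => f' (g x) * g' x).
Proof. by move=> df dg x; apply: is_derive1_comp. Qed.

Lemma has_deriv_affine (a b : R) f f' : has_deriv f f' ->
  has_deriv (fun x => f (a * x + b)) (fun x => a * f' (a * x + b)).
Proof.
move=> df; have dl : has_deriv (fun x => a * x + b) (fun=> a).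
  have := has_derivD (has_derivZ a has_deriv_id) (has_deriv_cst b).
  by move/has_deriv_eq; apply => x; rewrite mulr1 addr0.
by apply: has_deriv_eq (has_deriv_comp df dl) _ => x; rewrite mulrC.
Qed.

Lemma has_deriv_sin f f' : has_deriv f f' ->
  has_deriv (fun x => sin (f x)) (fun x => cos (f x) * f' x).
Proof. by apply: has_deriv_comp => x; exact: is_derive_sin. Qed.

Lemma has_deriv_cos f f' : has_deriv f f' ->
  has_deriv (fun x => cos (f x)) (fun x => - sin (f x) * f' x).
Proof.
move=> df; apply: (@has_deriv_comp cos f (fun x => - sin x)) => // x.
exact: is_derive_cos.
Qed.

Lemma has_derivV f f' : (forall x, f x != 0) -> has_deriv f f' ->
  has_deriv (fun x => (f x)^-1) (fun x => - f' x / f x ^+ 2).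
Proof.
move=> f0 df x; apply: is_derive_eq; first exact: is_deriveV (f0 x) (df x).
by rewrite /GRing.scale/= mulNr mulrC mulNr.
Qed.

Lemma has_deriv_sqrt f f' : (forall x, 0 < f x) -> has_deriv f f' ->
  has_deriv (fun x => Num.sqrt (f x)) (fun x => f' x / (2 * Num.sqrt (f x))).
Proof.
move=> f0 df x; apply: is_derive_eq.
  exact: (@is_derive1_comp _ Num.sqrt f _ _ _ (is_derive1_sqrt (f0 x)) (df x)).
by rewrite mulrC.
Qed.

Lemma has_deriv_expR f f' : has_deriv f f' ->
  has_deriv (fun x => expR (f x)) (fun x => expR (f x) * f' x).
Proof. by apply: has_deriv_comp => x; exact: is_derive_expR. Qed.

Lemma has_deriv_continuous f f' : has_deriv f f' -> continuous f.
Proof.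
move=> df x; have dx : derivable f x 1 by apply: ex_derive.
exact/differentiable_continuous/derivable1_diffP.
Qed.

Lemma has_deriv_within f f' (A : set R) :
  has_deriv f f' -> {within A, continuous f}.
Proof. by move/has_deriv_continuous => cf; exact: continuous_subspaceT. Qed.

Lemma has_deriv0_cst f : has_deriv f (fun=> 0) -> forall x y, f x = f y.
Proof. by move=> df x y; apply: is_derive_0_is_cst. Qed.

Lemma has_deriv_unique f g f' : has_deriv f f' -> has_deriv g f' ->
  forall x y, f x - g x = f y - g y.
Proof.
move=> df dg; apply: has_deriv0_cst.
by apply: has_deriv_eq (has_derivB df dg) _ => x; rewrite subrr.
Qed.

Lemma has_deriv_mvt f f' (a b : R) : a < b -> has_deriv f f' ->
  exists2 c, a < c < b & f b - f a = f' c * (b - a).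
Proof.
move=> ab df; have [|c cab E] := MVT ab (fun x _ => df x).
  exact: has_deriv_within df.
by exists c => //; move: cab; rewrite in_itv.
Qed.

Lemma has_deriv_le f f' (a b : R) : has_deriv f f' ->
  (forall x, a < x < b -> 0 <= f' x) -> a <= b -> f a <= f b.
Proof.
move=> df f0; rewrite le_eqVlt => /predU1P[->//|ab].
have [c cab E] := has_deriv_mvt ab df.
by rewrite -subr_ge0 E mulr_ge0 ?f0// subr_ge0 ltW.
Qed.

Lemma has_deriv_lt f f' (a b : R) : has_deriv f f' ->
  (forall x, a < x < b -> 0 < f' x) -> a < b -> f a < f b.
Proof.
move=> df f0 ab; have [c cab E] := has_deriv_mvt ab df.
by rewrite -subr_gt0 E mulr_gt0 ?f0// subr_gt0.
Qed.

Lemma continuous_integrable_itv f (a b : R) : continuous f ->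
  mu.-integrable `[a, b] (EFin \o f).
Proof.
move=> cf; apply: continuous_compact_integrable; first exact: segment_compact.
exact: continuous_subspaceT.
Qed.

Lemma has_deriv_ftc F f (a b : R) : has_deriv F f -> continuous f -> a <= b ->
  \int[mu]_(x in `[a, b]) f x = F b - F a.
Proof.
move=> dF cf; rewrite le_eqVlt => /predU1P[->|ab].
  by rewrite set_itv1 Rintegral_set1 subrr.
rewrite /Rintegral (@continuous_FTC2 _ f F)//.
- exact: continuous_subspaceT.
- split.
  + by move=> x _; apply: ex_derive.
  + exact/cvg_at_right_filter/(has_deriv_continuous dF).
  + exact/cvg_at_left_filter/(has_deriv_continuous dF).
- by move=> x _; rewrite (has_derivE dF).
Qed.

(** With [f := ellint k] this is, by definition, [ellF k]. *)
Definition oriented_integral f (p : R) : R :=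
  if 0 <= p then \int[mu]_(x in `[0, p]) f x
  else - \int[mu]_(x in `[p, 0]) f x.

Lemma oriented_integral0 f : oriented_integral f 0 = 0.
Proof. by rewrite /oriented_integral lexx set_itv1 Rintegral_set1. Qed.

Lemma oriented_integral_sub f (a p : R) : continuous f -> a <= 0 -> a <= p ->
  oriented_integral f p =
  \int[mu]_(x in `[a, p]) f x - \int[mu]_(x in `[a, 0]) f x.
Proof.
move=> cf a0 ap; rewrite /oriented_integral; have [p0|p0] := leP 0 p.
  rewrite (Rintegral_itvB (continuous_integrable_itv _ _ cf)) ?bnd_simp//.
  rewrite Rintegral_itv_obnd_cbnd//.
  apply: integrableS (continuous_integrable_itv (0) (p) cf) => //.
  exact: subset_itv_oc_cc.
have {}p0 := ltW p0.
rewrite -opprB (Rintegral_itvB (continuous_integrable_itv _ _ cf)) ?bnd_simp//.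
rewrite Rintegral_itv_obnd_cbnd//.
apply: integrableS (continuous_integrable_itv (p) (0) cf) => //.
exact: subset_itv_oc_cc.
Qed.

(** Near [x] the oriented integral differs by a constant from the integral
    over an interval starting to the left of both [x] and [0]. *)
Lemma has_deriv_oriented_integral f : continuous f ->
  has_deriv (oriented_integral f) f.
Proof.
move=> cf x; pose a := Num.min x 0 - 1.
have ax : a < x by rewrite /a ltrBlDr gt_min ltrDl ltr01.
have a0 : a < 0 by rewrite /a ltrBlDr gt_min orbC ltrDl ltr01.
have x1 : x < x + 1 by rewrite ltrDl.
have [dF F'] := continuous_FTC1_closed x1
  (continuous_integrable_itv (a) (x + 1) cf) ax (cf x).
pose F y := \int[mu]_(t in `[a, y]) f t.
apply: (@near_eq_is_derive _ _ _ (fun y => F y - F 0)).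
  near=> y; rewrite (@oriented_integral_sub _ a y)//; first exact: ltW.
  by apply: ltW; near: y; exact: lt_nbhsr.
have dFx : is_derive x 1 F (f x) by apply: DeriveDef => //; rewrite -derive1E.
by apply: is_derive_eq (is_deriveB dFx (is_derive_cst (F 0) x 1)) _; rewrite subr0.
Unshelve. all: by end_near. Qed.

End calculus.

(** * Smooth and smooth periodic functions *)

Section smoothness.
Context {R : realType}.
Implicit Types f g : R -> R.

(** An inductive form of n-fold differentiability: functions that satisfy a
    differential system are then shown smooth by induction on [n], the right
    hand sides being built from the same functions. *)
Fixpoint smooth_upto n f : Prop :=
  if n is m.+1 then exists2 g, has_deriv f g & smooth_upto m g else True.

Definition smooth f : Prop := forall n, smooth_upto n f.

Lemma smooth_upto_pred n f : smooth_upto n.+1 f -> smooth_upto n f.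
Proof.
elim: n f => [//|n IH] f [g fg gs].
by exists g => //; exact: IH.
Qed.

Lemma smooth_uptoD n f g :
  smooth_upto n f -> smooth_upto n g -> smooth_upto n (fun x => f x + g x).
Proof.
elim: n f g => [//|n IH] f g [f' df sf] [g' dg sg].
by exists (fun x => f' x + g' x); [exact: has_derivD|exact: IH].
Qed.

Lemma smooth_uptoM n f g :
  smooth_upto n f -> smooth_upto n g -> smooth_upto n (fun x => f x * g x).
Proof.
elim: n f g => [//|n IH] f g sf sg.
have [f' df sf'] := sf; have [g' dg sg'] := sg.
exists (fun x => f' x * g x + f x * g' x); first exact: has_derivM.
by apply: smooth_uptoD; apply: IH => //; exact: smooth_upto_pred.
Qed.

Lemma smooth_upto_cst n (a : R) : smooth_upto n (fun=> a).
Proof.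
elim: n a => [//|n IH] a.
by exists (fun=> 0); [exact: has_deriv_cst|exact: IH].
Qed.

Lemma smooth_has_deriv f f' : has_deriv f f' -> smooth f' -> smooth f.
Proof. by move=> df sf' [//|n]; exists f'. Qed.

Lemma has_deriv_smooth f f' : has_deriv f f' -> smooth f -> smooth f'.
Proof.
move=> df sf n; have [g dg sg] := sf n.+1.
by rewrite -(has_derivE df) (has_derivE dg).
Qed.

Lemma smooth_derive1 f : smooth f -> has_deriv f (derive1 f).
Proof. by move=> sf; have [g dg _] := sf 1%N; rewrite (has_derivE dg). Qed.

Lemma smooth_continuous f : smooth f -> continuous f.
Proof. by move/smooth_derive1/has_deriv_continuous. Qed.

Lemma smoothP f :
  smooth f <-> forall (n : nat) (x : R), derivable (derive1n n f) x 1.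
Proof.
split=> [sf n x|sf n].
  have : smooth (derive1n n f).
    elim: n => [//|n IH]; rewrite derive1nS.
    exact: has_deriv_smooth (smooth_derive1 IH) IH.
  by move/smooth_derive1/(_ x) => dx; apply: ex_derive.
elim: n f sf => [//|n IH] f sf; exists (derive1 f).
  by move=> x; apply: DeriveDef; [exact: (sf 0%N)|rewrite derive1E].
by apply: IH => m x; have := sf m.+1 x; rewrite /derive1n iterSr.
Qed.

Lemma smooth_cst (a : R) : smooth (fun=> a).
Proof. by move=> n; exact: smooth_upto_cst. Qed.

Lemma smooth_id : smooth (fun x : R => x).
Proof. exact: smooth_has_deriv has_deriv_id (smooth_cst 1). Qed.

Lemma smoothD f g : smooth f -> smooth g -> smooth (fun x => f x + g x).
Proof. by move=> sf sg n; exact: smooth_uptoD. Qed.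

Lemma smoothM f g : smooth f -> smooth g -> smooth (fun x => f x * g x).
Proof. by move=> sf sg n; exact: smooth_uptoM. Qed.

Lemma smoothZ (a : R) f : smooth f -> smooth (fun x => a * f x).
Proof. by move=> sf; apply: smoothM => //; exact: smooth_cst. Qed.

Lemma smoothN f : smooth f -> smooth (fun x => - f x).
Proof.
move=> /(smoothZ (-1)); congr smooth.
by apply/funext => x; rewrite mulN1r.
Qed.

Lemma smoothB f g : smooth f -> smooth g -> smooth (fun x => f x - g x).
Proof. by move=> sf sg; apply: smoothD => //; exact: smoothN. Qed.

(** Differentiating permutes [sin f] and [cos f] up to smooth factors, so both
    gain one degree of smoothness at a time. *)
Lemma smooth_sin_cos f :
  smooth f -> smooth (fun x => sin (f x)) /\ smooth (fun x => cos (f x)).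
Proof.
move=> sf; have df := smooth_derive1 sf.
have sf' := has_deriv_smooth df sf.
suff H n : smooth_upto n (fun x => sin (f x)) /\
           smooth_upto n (fun x => cos (f x)) by split=> n; case: (H n).
elim: n => [//|n [IHs IHc]]; split.
  exists (fun x => cos (f x) * derive1 f x); first exact: has_deriv_sin.
  exact: smooth_uptoM.
exists (fun x => - sin (f x) * derive1 f x); first exact: has_deriv_cos.
have := smooth_uptoM (smooth_uptoM (smooth_upto_cst n (-1)) IHs) (sf' n).
by congr smooth_upto; apply/funext => x; rewrite mulN1r.
Qed.

(** Composed with smooth periodic functions, it provides enough smooth periodic
    test functions to separate integrable ones. *)
Definition logistic (t : R) : R := (1 + expR (- t))^-1.

Lemma logistic_den_gt0 (t : R) : 0 < 1 + expR (- t).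
Proof. by rewrite addr_gt0// expR_gt0. Qed.

Lemma logistic_itv (t : R) : 0 <= logistic t <= 1.
Proof.
rewrite /logistic invr_ge0 ltW ?logistic_den_gt0//= invf_le1 ?logistic_den_gt0//.
by rewrite lerDl expR_ge0.
Qed.

Lemma smooth_logistic f : smooth f -> smooth (fun x => logistic (f x)).
Proof.
move=> sf; have df := smooth_derive1 sf.
have sf' := has_deriv_smooth df sf.
elim=> [//|n IH].
exists (fun x => derive1 f x * (logistic (f x) * (1 + -1 * logistic (f x)))).
  apply: has_deriv_eq.
    apply: has_derivV => [x|]; first by rewrite gt_eqF// logistic_den_gt0.
    apply: has_derivD (has_deriv_cst 1) _.
    exact: has_deriv_expR (has_derivN df).
  move=> x /=; rewrite /logistic; have := logistic_den_gt0 (f x).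
  by move: (expR _) => e e0; field; rewrite gt_eqF.
apply: smooth_uptoM => //; apply: smooth_uptoM => //.
by apply: smooth_uptoD; [|apply: smooth_uptoM => //]; exact: smooth_upto_cst.
Qed.

(** The second derivative is read off the equation, so the pair formed by a
    solution and its derivative gains one degree of smoothness at a time. *)
Lemma smooth_ode f f' V g : has_deriv f f' ->
  has_deriv f' (fun x => g x - V x * f x) -> smooth V -> smooth g -> smooth f.
Proof.
move=> df df' sV sg.
suff H n : smooth_upto n f /\ smooth_upto n f' by move=> n; case: (H n).
elim: n => [//|n [IH IH']]; split; first by exists f'.
exists (fun x => g x - V x * f x) => //.
rewrite (_ : (fun x => _) = fun x => g x + (-1) * (V x * f x)).
  apply: smooth_uptoD => //; apply: smooth_uptoM; first exact: smooth_upto_cst.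
  exact: smooth_uptoM.
by apply/funext => x; rewrite mulN1r.
Qed.

End smoothness.

Section periodic_functions.
Context {R : realType}.
Variable L : R.
Implicit Types f g : R -> R.

Lemma smooth_perP f : smooth_per L f <-> periodic f L /\ smooth f.
Proof. by split=> -[pf sf]; split=> //; apply/smoothP. Qed.

Lemma smooth_per_continuous f : smooth_per L f -> continuous f.
Proof. by case/smooth_perP => _ /smooth_continuous. Qed.

Lemma periodic_has_deriv f f' : has_deriv f f' -> periodic f L -> periodic f' L.
Proof.
move=> df pf x.
have dfL : has_deriv f (fun x => f' (x + L)).
  rewrite (_ : f = fun x => f (1 * x + L)); last first.
    by apply/funext => y; rewrite mul1r pf.
  by apply: has_deriv_eq (has_deriv_affine 1 L df) _ => y; rewrite !mul1r.
by have := has_derivE df; rewrite (has_derivE dfL) => /(congr1 (fun h => h x)).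
Qed.

Lemma smooth_per_deriv f f' : has_deriv f f' -> smooth_per L f ->
  smooth_per L f'.
Proof.
move=> df /smooth_perP[pf sf]; apply/smooth_perP; split.
  exact: periodic_has_deriv df pf.
exact: has_deriv_smooth df sf.
Qed.

Lemma smooth_per_has_deriv f : smooth_per L f -> has_deriv f (derive1 f).
Proof. by move=> /smooth_perP[_ /smooth_derive1]. Qed.

Lemma smooth_per_cst (a : R) : smooth_per L (fun=> a).
Proof. by apply/smooth_perP; split=> //; exact: smooth_cst. Qed.

Lemma smooth_perM f g : smooth_per L f -> smooth_per L g ->
  smooth_per L (fun x => f x * g x).
Proof.
move=> /smooth_perP[pf sf] /smooth_perP[pg sg]; apply/smooth_perP.
by split; [move=> x; rewrite pf pg|exact: smoothM].
Qed.

Lemma smooth_perZ (a : R) f : smooth_per L f -> smooth_per L (fun x => a * f x).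
Proof. by apply: smooth_perM; exact: smooth_per_cst. Qed.

Lemma smooth_perB f g : smooth_per L f -> smooth_per L g ->
  smooth_per L (fun x => f x - g x).
Proof.
move=> /smooth_perP[pf sf] /smooth_perP[pg sg]; apply/smooth_perP.
by split; [move=> x; rewrite pf pg|exact: smoothB].
Qed.

End periodic_functions.

(** * Duality between integrable functions and smooth periodic functions *)

Section duality.
Context {R : realType}.
Variable L : R.
Hypothesis L0 : 0 < L.
Implicit Types f g h : R -> R.
Notation mu := (@lebesgue_measure R).

Lemma bounded_continuous_itv f (a b : R) : continuous f ->
  [bounded f x | x in `[a, b]].
Proof.
move=> cf; have cfab : {within `[a, b], continuous f}.
  exact: continuous_subspaceT.
have /compact_bounded[M [_ mrt]] := continuous_compact cfab (@segment_compact _ a b).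
by exists M; split; rewrite ?num_real // => ? ? ? ?; exact: mrt.
Qed.

Lemma integrable_mul_continuous f g (a b : R) :
  mu.-integrable `[a, b] (EFin \o f) -> continuous g ->
  mu.-integrable `[a, b] (EFin \o (fun x => f x * g x)).
Proof.
move=> intf cg.
have mg : measurable_fun `[a, b] g.
  by apply: measurable_funTS; exact: continuous_measurable_fun cg.
have := integrableMl _ intf mg (bounded_continuous_itv a b cg).
move=> /(_ (measurable_itv _)).
by congr integrable; apply/funext => x.
Qed.

Lemma Rintegral_lin f g (a b c d : R) :
  mu.-integrable `[a, b] (EFin \o f) -> mu.-integrable `[a, b] (EFin \o g) ->
  \int[mu]_(x in `[a, b]) (c * f x + d * g x) =
  c * (\int[mu]_(x in `[a, b]) f x) + d * (\int[mu]_(x in `[a, b]) g x).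
Proof.
move=> intf intg.
have Z k h : mu.-integrable `[a, b] (EFin \o h) ->
    mu.-integrable `[a, b] (EFin \o (fun x => k * h x)).
  move=> inth; have := integrableZl _ k inth; move=> /(_ (measurable_itv _)).
  by congr integrable; apply/funext => x.
by rewrite RintegralD ?RintegralZl//; apply: Z.
Qed.

(** Dominated by [1 + f ^+ 2], as [0, L] has finite measure. *)
Lemma L2per_integrable f : L2per L f -> mu.-integrable `[0, L] (EFin \o f).
Proof.
move=> [_ f2].
have := Lfun2_integrable_sqr f2; set g := f \_ `[0, L] => ig.
have mg : measurable_fun setT g.
  by move: f2; rewrite inE => /andP[/[!inE]/=].
have ig' : mu.-integrable `[0, L] (EFin \o (fun x => 1 + g x ^+ 2)).
  have i1 := continuous_integrable_itv 0 L (@cst_continuous _ _ (1 : R)).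
  have i2 : mu.-integrable `[0, L] (EFin \o (fun x => g x ^+ 2)).
    exact: integrableS ig.
  have := integrableD _ i1 i2; move=> /(_ (measurable_itv _)).
  by congr integrable; apply/funext => x.
apply: (@eq_integrable _ _ _ mu `[0, L] _ (EFin \o g)) => //.
  by move=> x xL; rewrite /= /g patchE xL.
apply: le_integrable ig' => //.
  by apply/measurable_EFinP; exact: measurable_funTS.
move=> x _ /=; rewrite lee_fin [leRHS]ger0_norm; last first.
  by rewrite addr_ge0// sqr_ge0.
rewrite -[g x ^+ 2]real_normK ?num_real//.
by have := sqr_ge0 (`|g x| - 1); have := normr_ge0 (g x); nra.
Qed.

Lemma L2per_continuous f : periodic f L -> continuous f -> L2per L f.
Proof.
move=> pf cf; split=> //.
have mf : measurable_fun setT f by exact: continuous_measurable_fun.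
have mfL : measurable_fun setT (f \_ `[0, L]).
  by apply/(measurable_restrictT _ _).1 => //; exact: measurable_funTS.
rewrite inE; apply/andP; split; rewrite inE//=.
rewrite /finite_norm unlock poweR_lty//.
have cf2 : continuous (fun x => f x ^+ 2).
  move=> x; apply: (@continuous_comp _ _ _ f (fun y => y ^+ 2)); first exact: cf.
  exact: (@exprn_continuous R 2 (f x)).
have := continuous_integrable_itv 0 L cf2.
rewrite integrable_mkcond// => /integrableP[_].
apply: le_lt_trans; rewrite le_eqVlt; apply/orP; left; apply/eqP.
apply: eq_integral => x _ /=.
rewrite !patchE; case: ifP => _ /=; last by rewrite normr0 powR0// pnatr_eq0.
by rewrite powR_mulrn// real_normK ?num_real// ger0_norm// sqr_ge0.
Qed.

Lemma ae_eq_Rintegral f g h : ae_eqL L f g ->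
  mu.-integrable `[0, L] (EFin \o f) -> mu.-integrable `[0, L] (EFin \o g) ->
  continuous h ->
  \int[mu]_(x in `[0, L]) (f x * h x) = \int[mu]_(x in `[0, L]) (g x * h x).
Proof.
move=> fg intf intg ch; rewrite /Rintegral; congr fine.
apply: ae_eq_integral => //.
- by have /integrableP[] := integrable_mul_continuous intf ch.
- by have /integrableP[] := integrable_mul_continuous intg ch.
- apply: (filterS _ fg); first exact: (ae_filter_ringOfSetsType mu).
  by move=> x /= fgx /fgx ->.
Qed.

Lemma logisticN (t : R) : logistic (- t) = 1 - logistic t.
Proof.
rewrite /logistic opprK expRN; have := expR_gt0 t; move: (expR t) => e e0.
by field; rewrite !gt_eqF// ?addr_gt0.
Qed.

Lemma logistic_cvg1 (t : R) : 0 < t -> logistic (n%:R * t) @[n --> \oo] --> (1 : R).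
Proof.
move=> t0.
have e0 : expR (- (n%:R * t)) @[n --> \oo] --> (0 : R).
  under eq_cvg do rewrite -mulrN mulrC expRM_natr.
  by apply: cvg_expr; rewrite ger0_norm ?expR_ge0// expR_lt1 oppr_lt0.
have e1 : 1 + expR (- (n%:R * t)) @[n --> \oo] --> (1 : R).
  by rewrite -[X in _ --> X]addr0; apply: cvgD => //; exact: cvg_cst.
by have := cvgV (oner_neq0 R) e1; rewrite invr1; apply.
Qed.

Lemma logistic_cvg0 (t : R) : t < 0 -> logistic (n%:R * t) @[n --> \oo] --> (0 : R).
Proof.
move=> t0; rewrite -[X in _ --> X](subrr (1 : R)).
under eq_cvg => n do rewrite -[n%:R * t]opprK logisticN -mulrN.
by apply: cvgB; [exact: cvg_cst|apply: logistic_cvg1; rewrite oppr_gt0].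
Qed.

(** Positive on ]0, b[ and negative on ]b, L[. *)
Definition arc_sign (b x : R) : R := sin (pi / L * x) * sin (pi / L * (b - x)).

Lemma smooth_per_arc_sign n b :
  smooth_per L (fun x => logistic (n%:R * arc_sign b x)).
Proof.
have piL : pi / L * L = pi by rewrite divfK// gt_eqF.
apply/smooth_perP; split.
  move=> x; congr (logistic (_ * _)); rewrite /arc_sign.
  rewrite mulrDr piL sinDpi opprD addrA mulrBr piL.
  by rewrite -[in RHS](subrK pi (pi / L * (b - x))) sinDpi mulrN mulNr.
apply: smooth_logistic; apply: smoothZ; apply: smoothM.
  by apply: (smooth_sin_cos _).1; apply: smoothZ; exact: smooth_id.
apply: (smooth_sin_cos _).1; apply: smoothZ; apply: smoothB.
  exact: smooth_cst.
exact: smooth_id.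
Qed.

Lemma sin_piL_gt0 (x : R) : 0 < x < L -> 0 < sin (pi / L * x).
Proof.
move=> /andP[x0 xL]; apply: sin_gt0_pi; rewrite mulr_gt0 ?divr_gt0 ?pi_gt0//=.
by rewrite mulrAC ltr_pdivrMr// ltr_pM2l ?pi_gt0.
Qed.

(** The functions [logistic (n%:R * arc_sign b x)] converge boundedly to the
    indicator of [0, b], except at three points. *)
Lemma Rintegral_initial_eq0 f (b : R) : mu.-integrable `[0, L] (EFin \o f) ->
  (forall eta, smooth_per L eta -> \int[mu]_(x in `[0, L]) (f x * eta x) = 0) ->
  0 < b < L -> \int[mu]_(x in `[0, b]) f x = 0.
Proof.
move=> intf f0 /andP[b0 bL].
pose e n x := logistic (n%:R * arc_sign b x).
pose F x := f x * \1_`[0, b] x.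
have ce n : continuous (e n) by exact/smooth_per_continuous/smooth_per_arc_sign.
have mf : measurable_fun `[0, L] (EFin \o f) by case/integrableP : intf.
have [|||||_ _] := @dominated_convergence _ _ R mu `[0, L] (measurable_itv _)
   (fun n x => (f x * e n x)%:E) (EFin \o F) (fun x => `|f x|%:E).
- move=> n; have /integrableP[] // := integrable_mul_continuous intf (ce n).
- apply/measurable_EFinP; apply: measurable_funM.
    exact/measurable_EFinP.
  exact: measurable_funTS.
- exists [set 0; b; L]; split.
  + by apply: measurableU => //; exact: measurableU.
  + apply: countable_lebesgue_measure0; apply: finite_set_countable.
    by rewrite !finite_setU; do ?split; exact: finite_set1.
  + move=> x /= /not_implyP[]; rewrite in_itv/= => /andP[x0 xL]; apply: contra_notP.
    move=> /not_orP[/not_orP[/eqP nx0 /eqP nxb] /eqP nxL].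
    have {}x0 : 0 < x by rewrite lt_neqAle eq_sym nx0.
    have {}xL : x < L by rewrite lt_neqAle nxL.
    apply: cvg_EFin; first exact: nearW.
    rewrite /= /F; apply: cvgM; first exact: cvg_cst.
    rewrite indicE; have [xb|bx] := leP x b.
      rewrite mem_set; last by rewrite /= in_itv/= xb ltW.
      apply: logistic_cvg1; apply: mulr_gt0; apply: sin_piL_gt0; first by rewrite x0.
      have {}xb : x < b by rewrite lt_neqAle nxb.
      by rewrite subr_gt0 xb/=; lra.
    rewrite memNset; last by rewrite /= in_itv/= [x <= b]leNgt bx andbF.
    apply: logistic_cvg0; rewrite /arc_sign -opprB mulrN sinN mulrN oppr_lt0.
    apply: mulr_gt0; apply: sin_piL_gt0; first by rewrite x0.
    by rewrite subr_gt0 bx/=; lra.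
- exact: integrable_abse intf.
- apply: aeW => x n _ /=; rewrite lee_fin normrM ler_piMr//.
  by have /andP[? ?] := logistic_itv (n%:R * arc_sign b x); rewrite ger0_norm.
have -> : (fun n => \int[mu]_(x in `[0%R, L]) ((f x * e n x)%R)%:E)%E = cst 0%E.
  apply/funext => n /=.
  have /integrable_fin_num/fineK <- // := integrable_mul_continuous intf (ce n).
  by have := f0 _ (smooth_per_arc_sign n b); rewrite /Rintegral => ->.
move=> /cvg_lim; rewrite lim_cst// => /(_ _)/esym H.
rewrite /Rintegral (_ : (\int[mu]_(x in _) _)%E = 0%E)//.
rewrite -[RHS]H//; have -> : EFin \o F = (EFin \o f) \_ `[0, b].
  apply/funext => x /=; rewrite /F patchE indicE.
  by case: (x \in _); rewrite ?mulr1 ?mulr0.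
rewrite -integral_mkcondr setIidr//; apply: subset_itvl; rewrite bnd_simp.
exact: ltW.
Qed.

(** The primitive of [f] vanishes, and by Lebesgue differentiation its
    derivative is [f] almost everywhere. *)
Lemma orthogonal_smooth_per f : mu.-integrable `[0, L] (EFin \o f) ->
  (forall eta, smooth_per L eta -> \int[mu]_(x in `[0, L]) (f x * eta x) = 0) ->
  ae_eqL L f (cst 0).
Proof.
move=> intf f0; pose g := f \_ `[0, L].
have intg : mu.-integrable setT (EFin \o g).
  by rewrite /g -restrict_EFin -integrable_mkcond.
have := @FTC1 R g (BLeft 0).
move=> [|| N [mN N0 sN]].
- by move=> y; exact: integrableS intg.
- exact: integrable_locally.
exists (N `|` [set 0; L]); split.
- by apply: measurableU => //; exact: measurableU.
- rewrite measureU0//; first exact: measurableU.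
  apply: countable_lebesgue_measure0; apply: finite_set_countable.
  by rewrite finite_setU; split; exact: finite_set1.
move=> x /= /not_implyP[]; rewrite in_itv/= => /andP[x0 xL] fx.
have [->|nx0] := eqVneq x 0; first by right; left.
have [->|nxL] := eqVneq x L; first by right; right.
have {}x0 : 0 < x by rewrite lt_neqAle eq_sym nx0.
have {}xL : x < L by rewrite lt_neqAle nxL.
left; apply: sN => /=; apply: contra_not fx => /(_ _)[|_]; first by rewrite lte_fin.
rewrite derive1E (@near_eq_derive _ _ _ _ (cst 0)).
- by rewrite derive_cst /g patchE mem_set//= in_itv/= !ltW.
near=> y; have y0 : 0 < y by near: y; exact: lt_nbhsr.
have yL : y < L by near: y; exact: lt_nbhsl.
rewrite -[RHS](@Rintegral_initial_eq0 f y)//; last by rewrite y0.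
apply: eq_Rintegral => z; rewrite inE/= in_itv/= => /andP[z0 zy].
by rewrite /g patchE mem_set//= in_itv/= z0 (le_trans zy)// ltW.
Unshelve. all: by end_near. Qed.

End duality.

(** * The linearized equation along a periodic solution *)

Section linearization.
Context {R : realType}.
Variables (L beta gam : R) (w w1 : R -> R).
Hypotheses (L0 : 0 < L) (beta0 : 0 < beta) (gam0 : 0 < gam) (gam4 : gam < 4).
Hypotheses (w_per : smooth_per L w) (w_gt0 : forall x, 0 < w x).
Hypothesis dw : has_deriv w w1.
Hypothesis dw1 : has_deriv w1 (fun x => beta * (12 * w x - 6 * w x ^+ 2)).
Hypothesis w1_sqr : forall x,
  w1 x ^+ 2 = - 4 * beta * (w x ^+ 3 - 3 * w x ^+ 2 + gam).
Implicit Types f g eta : R -> R.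
Notation mu := (@lebesgue_measure R).

(** In these variables the linearized operator is, up to the factor
    [- cspeed L k], the operator [f'' + potential * f]. *)
Definition potential x : R := beta * (30 * w x - 48).

Definition periodic_sol x : R := w x * w1 x.

Definition periodic_sol' x : R :=
  beta * (- 10 * w x ^+ 3 + 24 * w x ^+ 2 - 4 * gam).

Let b : R := 5 * gam - 24.

(** A second solution is sought as the sum of [periodic_sol * Z] and a cubic
    polynomial in [w], where [Z] has a derivative affine in [w].  Comparing
    coefficients gives five linear equations for the six unknown coefficients,
    whose solution, unique up to a factor, is [drift] and [bounded_part]. *)
Definition drift x : R := 2 * gam + b * w x.

Definition secular : R -> R := oriented_integral drift.

Definition bounded_part x : R :=
  6 * gam * (4 - gam) - 4 * gam * w x + (34 * gam - 144) * w x ^+ 2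
  + (48 - 10 * gam) * w x ^+ 3.

Definition bounded_part' x : R :=
  (- 4 * gam + 2 * (34 * gam - 144) * w x + 3 * (48 - 10 * gam) * w x ^+ 2)
  * w1 x.

Definition secular_sol x : R := periodic_sol x * secular x + bounded_part x.

Definition secular_sol' x : R :=
  periodic_sol' x * secular x + periodic_sol x * drift x + bounded_part' x.

Definition wronskian : R := 24 * beta * gam ^+ 2 * (4 - gam).

Lemma smooth_per_w1 : smooth_per L w1.
Proof. exact: smooth_per_deriv dw w_per. Qed.

Lemma has_deriv_w_exp n :
  has_deriv (fun x => w x ^+ n) (fun x => n%:R * w x ^+ n.-1 * w1 x).
Proof. exact: has_derivX. Qed.

Lemma periodic_solP : has_deriv periodic_sol periodic_sol'.
Proof.
apply: has_deriv_eq (has_derivM dw dw1) _ => x.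
by rewrite /periodic_sol' -expr2 w1_sqr; ring.
Qed.

Lemma periodic_sol'P : has_deriv periodic_sol' (fun x => - potential x * periodic_sol x).
Proof.
have := has_derivZ beta (has_derivB (has_derivD
  (has_derivZ (- 10) (has_deriv_w_exp 3)) (has_derivZ 24 (has_deriv_w_exp 2)))
  (has_deriv_cst (4 * gam))).
move/has_deriv_eq; apply => x /=.
by rewrite /potential /periodic_sol; ring.
Qed.

Lemma smooth_per_periodic_sol : smooth_per L periodic_sol.
Proof. exact: smooth_perM w_per smooth_per_w1. Qed.

Lemma continuous_drift : continuous drift.
Proof.
exact: has_deriv_continuous (has_derivD (has_deriv_cst _) (has_derivZ b dw)).
Qed.

Lemma secularP : has_deriv secular drift.
Proof. exact: has_deriv_oriented_integral continuous_drift. Qed.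

Lemma bounded_partP : has_deriv bounded_part bounded_part'.
Proof.
have := has_derivD (has_derivD (has_derivB
  (has_deriv_cst (6 * gam * (4 - gam))) (has_derivZ (4 * gam) dw))
  (has_derivZ (34 * gam - 144) (has_deriv_w_exp 2)))
  (has_derivZ (48 - 10 * gam) (has_deriv_w_exp 3)).
move/has_deriv_eq; apply => x /=.
by rewrite /bounded_part'; ring.
Qed.

Lemma secular_solP : has_deriv secular_sol secular_sol'.
Proof.
have := has_derivD (has_derivM periodic_solP secularP) bounded_partP.
by move/has_deriv_eq; apply.
Qed.

Lemma secular_sol'P : has_deriv secular_sol' (fun x => - potential x * secular_sol x).
Proof.
have dd : has_deriv drift (fun x => b * w1 x).
  apply: has_deriv_eq (has_derivD (has_deriv_cst _) (has_derivZ b dw)) _ => x.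
  by rewrite add0r.
have db : has_deriv bounded_part' (fun x =>
    (2 * (34 * gam - 144) * w1 x + 6 * (48 - 10 * gam) * w x * w1 x) * w1 x
    + (- 4 * gam + 2 * (34 * gam - 144) * w x
       + 3 * (48 - 10 * gam) * w x ^+ 2)
      * (beta * (12 * w x - 6 * w x ^+ 2))).
  have := has_derivM (has_derivD (has_derivD (has_deriv_cst (- 4 * gam))
    (has_derivZ (2 * (34 * gam - 144)) dw))
    (has_derivZ (3 * (48 - 10 * gam)) (has_deriv_w_exp 2))) dw1.
  by move/has_deriv_eq; apply => x /=; ring.
have := has_derivD (has_derivD (has_derivM periodic_sol'P secularP)
  (has_derivM periodic_solP dd)) db.
move/has_deriv_eq; apply => x /=.
rewrite /secular_sol /potential /bounded_part /periodic_sol /periodic_sol' /drift /b.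
move: (secular x) (w1_sqr x) => Z E.
by ring: E.
Qed.

Lemma wronskianE x :
  periodic_sol x * secular_sol' x - periodic_sol' x * secular_sol x = wronskian.
Proof.
rewrite /secular_sol /secular_sol' /periodic_sol /periodic_sol' /drift /b.
rewrite /bounded_part /bounded_part' /wronskian.
move: (secular x) (w1_sqr x) => Z E.
by ring: E.
Qed.

Lemma wronskian_neq0 : wronskian != 0.
Proof.
by rewrite /wronskian !mulf_neq0// ?expf_neq0 ?gt_eqF// subr_gt0.
Qed.

(** Up to the derivative of a periodic function,
    [- drift = 5 * (w ^+ 3 - gam * w) = 5 * (w * (w - 2) ^+ 2 + (4 - gam) * w)],
    which is positive.  The correction removes the averages of [w1'] and of
    [(w * w1)'], which express [w ^+ 2] and [w ^+ 3] in lower powers. *)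
Lemma secular_L_neq0 : secular L != 0.
Proof.
pose M x := secular x + (periodic_sol x / 2 - 4 / 3 * w1 x) / beta.
have dM : has_deriv M
    (fun x => - (5 * (w x * (w x - 2) ^+ 2 + (4 - gam) * w x))).
  have := has_derivD secularP (has_derivZ beta^-1 (has_derivB
    (has_derivZ 2^-1 periodic_solP) (has_derivZ (4 / 3) dw1))).
  rewrite (_ : (fun x => secular x + _) = M); last first.
    by apply/funext => x; rewrite /M [in RHS]mulrC [_ / 2]mulrC.
  move/has_deriv_eq; apply => x; rewrite /drift /periodic_sol' /b.
  by field; rewrite gt_eqF.
have : M 0 > M L.
  rewrite -ltrN2; apply: (has_deriv_lt (has_derivN dM)) => // x _.
  rewrite opprK mulr_gt0//; apply: ltr_wpDl.
    by rewrite mulr_ge0 ?sqr_ge0// ltW.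
  by rewrite mulr_gt0// subr_gt0.
have per f : smooth_per L f -> f L = f 0.
  by case=> pf _; rewrite -(pf 0) add0r.
rewrite /M (per _ smooth_per_periodic_sol) (per _ smooth_per_w1) ltrD2r.
by rewrite [secular 0]oriented_integral0 => /lt_eqF ->.
Qed.

Lemma secularDL x : secular (x + L) = secular x + secular L.
Proof.
have dL : has_deriv (fun x => secular (1 * x + L)) drift.
  apply: has_deriv_eq (has_deriv_affine 1 L secularP) _ => y.
  by rewrite !mul1r /drift; case: w_per => pw _; rewrite pw.
have := has_deriv_unique dL secularP x 0.
rewrite mul1r mul1r add0r [secular 0]oriented_integral0 subr0.
by move=> <-; ring.
Qed.

Lemma secular_solDL x : secular_sol (x + L) = secular_sol x + secular L * periodic_sol x.
Proof.
rewrite /secular_sol secularDL /bounded_part.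
have [pf _] := smooth_per_periodic_sol; have [pw _] := w_per.
by rewrite pf pw; ring.
Qed.

Lemma continuous_periodic_sol : continuous periodic_sol.
Proof. exact: has_deriv_continuous periodic_solP. Qed.

(** Otherwise the solution vanishes inside the period together with its
    derivative, against the Wronskian identity. *)
Lemma norm_periodic_sol_gt0 :
  0 < \int[mu]_(x in `[0, L]) (periodic_sol x * periodic_sol x).
Proof.
pose S := oriented_integral (fun x => periodic_sol x * periodic_sol x).
have dS : has_deriv S (fun x => periodic_sol x * periodic_sol x).
  apply: has_deriv_oriented_integral.
  exact: has_deriv_continuous (has_derivM periodic_solP periodic_solP).
have S0 : S 0 = 0 by exact: oriented_integral0.
have -> : \int[mu]_(x in `[0, L]) (periodic_sol x * periodic_sol x) = S L.
  by rewrite /S /oriented_integral ltW.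
have Sle x y : x <= y -> S x <= S y.
  by apply: (has_deriv_le dS) => z _; rewrite -expr2 sqr_ge0.
rewrite lt_neqAle -{2}S0 Sle ?andbT; last exact: ltW.
apply/negP => /eqP SL.
have Scst x : 0 < x < L -> S x = 0.
  by move=> /andP[x0 xL]; apply/eqP; rewrite eq_le {1}SL -S0 !Sle ?ltW.
have f0 x : 0 < x < L -> periodic_sol x = 0.
  move=> /andP[x0 xL]; apply/eqP; rewrite -sqrf_eq0 expr2; apply/eqP.
  have <- : derive1 S x = periodic_sol x * periodic_sol x by rewrite (has_derivE dS).
  rewrite derive1E (@near_eq_derive _ _ _ _ (cst 0)).
    by rewrite derive_cst.
  near=> y; apply: Scst; apply/andP; split; near: y; first exact: lt_nbhsr.
  exact: lt_nbhsl.
have L2 : 0 < L / 2 < L by rewrite divr_gt0//= ltr_pdivrMr// ltr_pMr// ltr1n.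
have g0 : periodic_sol' (L / 2) = 0.
  rewrite -(has_derivE periodic_solP) derive1E (@near_eq_derive _ _ _ _ (cst 0)).
    by rewrite derive_cst.
  case/andP: L2 => L20 L2L.
  near=> y; apply: f0; apply/andP; split; near: y; first exact: lt_nbhsr.
  exact: lt_nbhsl.
have /eqP := wronskianE (L / 2).
by rewrite g0 f0// !mul0r subrr eq_sym (negbTE wronskian_neq0).
Unshelve. all: by end_near. Qed.

(** Variation of parameters.  Since [secular_sol] picks up a nonzero multiple of
    [periodic_sol] over a period, adding a multiple of it makes any
    particular solution periodic. *)
Lemma forced_solution g : smooth_per L g ->
  \int[mu]_(x in `[0, L]) (periodic_sol x * g x) = 0 ->
  exists eta eta', [/\ smooth_per L eta, has_deriv eta eta' &
    has_deriv eta' (fun x => g x - potential x * eta x)].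
Proof.
move=> gs g0.
have cg : continuous g by exact: smooth_per_continuous gs.
have dg := smooth_per_has_deriv gs.
pose A := oriented_integral (fun x => secular_sol x * g x).
pose B := oriented_integral (fun x => periodic_sol x * g x).
have dA : has_deriv A (fun x => secular_sol x * g x).
  apply: has_deriv_oriented_integral.
  exact: has_deriv_continuous (has_derivM secular_solP dg).
have dB : has_deriv B (fun x => periodic_sol x * g x).
  apply: has_deriv_oriented_integral.
  exact: has_deriv_continuous (has_derivM periodic_solP dg).
have A0 : A 0 = 0 by exact: oriented_integral0.
have B0 : B 0 = 0 by exact: oriented_integral0.
have BL : B L = 0 by rewrite /B /oriented_integral ltW.
have [pf _] := smooth_per_periodic_sol.
have [pg _] := gs.
have BDL x : B (x + L) = B x.
  have dBL : has_deriv (fun x => B (1 * x + L)) (fun x => periodic_sol x * g x).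
    apply: has_deriv_eq (has_deriv_affine 1 L dB) _ => y.
    by rewrite !mul1r pf pg.
  have := has_deriv_unique dBL dB x 0.
  by rewrite !mul1r add0r BL B0 subrr => /eqP; rewrite subr_eq0 => /eqP.
have ADL x : A (x + L) = A L + A x + secular L * B x.
  have dAL : has_deriv (fun x => A (1 * x + L))
      (fun x => secular_sol x * g x + secular L * (periodic_sol x * g x)).
    apply: has_deriv_eq (has_deriv_affine 1 L dA) _ => y.
    by rewrite !mul1r pg secular_solDL; ring.
  have := has_deriv_unique dAL (has_derivD dA (has_derivZ (secular L) dB)) x 0.
  by rewrite !mul1r add0r A0 B0 => E; move: (A (x + L)) E => a E; lra.
have W0 := wronskian_neq0; have Z0 := secular_L_neq0.
pose kap := A L / secular L.
pose eta x :=
  wronskian^-1 * (secular_sol x * B x - periodic_sol x * A x + kap * secular_sol x).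
pose eta' x :=
  wronskian^-1 * (secular_sol' x * B x - periodic_sol' x * A x + kap * secular_sol' x).
have deta : has_deriv eta eta'.
  have := has_derivZ wronskian^-1 (has_derivD (has_derivB (has_derivM secular_solP dB)
    (has_derivM periodic_solP dA)) (has_derivZ kap secular_solP)).
  by move/has_deriv_eq; apply => x; rewrite /eta'; ring.
have deta' : has_deriv eta' (fun x => g x - potential x * eta x).
  have := has_derivZ wronskian^-1 (has_derivD (has_derivB (has_derivM secular_sol'P dB)
    (has_derivM periodic_sol'P dA)) (has_derivZ kap secular_sol'P)).
  move/has_deriv_eq; apply => x.
  have E : g x = wronskian^-1 *
      (periodic_sol x * secular_sol' x - periodic_sol' x * secular_sol x) * g x.
    by rewrite wronskianE mulVf// mul1r.
  by rewrite [in RHS]E /eta; ring.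
exists eta, eta'; split; [|exact: deta|exact: deta']; apply/smooth_perP; split.
  move=> x; rewrite /eta ADL BDL secular_solDL pf /kap.
  by field; rewrite Z0 W0.
apply: (smooth_ode deta deta'); last by case/smooth_perP: gs.
apply: smoothZ; apply: smoothB; last exact: smooth_cst.
by apply: smoothZ; case/smooth_perP: w_per.
Qed.

Definition weak_kernel f : Prop := forall eta eta' eta'',
  smooth_per L eta -> has_deriv eta eta' -> has_deriv eta' eta'' ->
  \int[mu]_(x in `[0, L]) (f x * (eta'' x + potential x * eta x)) = 0.

(** [f] annihilates the range of the operator, which contains every test
    function orthogonal to [periodic_sol]; hence it is orthogonal to every test
    function after subtraction of its projection on [periodic_sol]. *)
Lemma weak_kernel_line f : mu.-integrable `[0, L] (EFin \o f) ->
  weak_kernel f -> exists a, ae_eqL L f (fun x => a * periodic_sol x).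
Proof.
move=> intf kf.
have S0 := norm_periodic_sol_gt0.
set S := (X in 0 < X) in S0.
pose I := \int[mu]_(x in `[0, L]) (f x * periodic_sol x).
exists (I / S).
have co := continuous_periodic_sol.
have into : mu.-integrable `[0, L] (EFin \o periodic_sol).
  exact: continuous_integrable_itv.
have intfo := integrable_mul_continuous intf co.
have intoo := integrable_mul_continuous into co.
pose h x := 1 * f x + (- (I / S)) * periodic_sol x.
suff H : ae_eqL L h (cst 0).
  apply: (filterS _ H); first exact: (ae_filter_ringOfSetsType mu).
  move=> x /= hx /hx /eqP.
  by rewrite /h mul1r addr_eq0 mulNr opprK => /eqP.
apply: orthogonal_smooth_per => //.
  have : mu.-integrable `[0, L] (EFin \o (fun x => f x - I / S * periodic_sol x)).
    have i2 : mu.-integrable `[0, L] (EFin \o (fun x => I / S * periodic_sol x)).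
      apply: continuous_integrable_itv.
      exact: has_deriv_continuous (has_derivZ (I / S) periodic_solP).
    have := integrableB _ intf i2; move=> /(_ (measurable_itv _)).
    by congr integrable; apply/funext => x.
  by congr integrable; apply/funext => x; rewrite /h /= mul1r mulNr.
move=> eta eta_per.
have ce := smooth_per_continuous eta_per.
have intfe := integrable_mul_continuous intf ce.
have intoe := integrable_mul_continuous into ce.
pose J := \int[mu]_(x in `[0, L]) (periodic_sol x * eta x).
pose g x := eta x - J / S * periodic_sol x.
have gs : smooth_per L g.
  exact: smooth_perB eta_per (smooth_perZ _ smooth_per_periodic_sol).
have og : \int[mu]_(x in `[0, L]) (periodic_sol x * g x) = 0.
  transitivity (\int[mu]_(x in `[0, L]) (1 * (periodic_sol x * eta x)
    + (- (J / S)) * (periodic_sol x * periodic_sol x))).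
    by apply: eq_Rintegral => x _; rewrite /g; ring.
  by rewrite Rintegral_lin// -/J -/S; field; rewrite gt_eqF.
have [xi [xi' [xis dxi dxi']]] := forced_solution gs og.
have := kf _ _ _ xis dxi dxi'.
have -> : \int[mu]_(x in `[0, L])
      (f x * (g x - potential x * xi x + potential x * xi x)) =
    \int[mu]_(x in `[0, L]) (1 * (f x * eta x) + (- (J / S)) * (f x * periodic_sol x)).
  by apply: eq_Rintegral => x _; rewrite /g; ring.
rewrite Rintegral_lin// -/I => E.
transitivity (\int[mu]_(x in `[0, L])
    (1 * (f x * eta x) + (- (I / S)) * (periodic_sol x * eta x))).
  by apply: eq_Rintegral => x _; rewrite /h; ring.
rewrite Rintegral_lin// -/J -[RHS]E; congr (_ + _).
by field; rewrite gt_eqF.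
Qed.

End linearization.

(** * Elliptic integrals and Jacobi functions *)

Section elliptic_functions.
Context {R : realType}.
Variable k : R.
Hypothesis k01 : 0 < k < 1.
Notation m := (k ^+ 2).

Definition jacobi_delta (p : R) : R := Num.sqrt (1 - m * sin p ^+ 2).

Lemma modulus_sqr_itv : 0 < m < 1.
Proof.
have /andP[k0 k1] := k01.
by rewrite exprn_gt0//= expr_lt1// ltW.
Qed.

Lemma jacobi_delta_arg_gt0 (p : R) : 0 < 1 - m * sin p ^+ 2.
Proof.
have /andP[m0 m1] := modulus_sqr_itv.
by have := sin2cos2 p; have := sqr_ge0 (cos p); have := sqr_ge0 (sin p); nra.
Qed.

Lemma jacobi_delta_gt0 (p : R) : 0 < jacobi_delta p.
Proof. by rewrite sqrtr_gt0 jacobi_delta_arg_gt0. Qed.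

Lemma jacobi_delta_sqr (p : R) : jacobi_delta p ^+ 2 = 1 - m * sin p ^+ 2.
Proof. by rewrite sqr_sqrtr// ltW// jacobi_delta_arg_gt0. Qed.

Lemma jacobi_delta_le1 (p : R) : jacobi_delta p <= 1.
Proof.
have /andP[m0 m1] := modulus_sqr_itv.
rewrite -(@expr_le1 _ 2)// ?jacobi_delta_sqr; last exact/ltW/jacobi_delta_gt0.
by rewrite gerBl mulr_ge0 ?sqr_ge0.
Qed.

Lemma has_deriv_jacobi_delta :
  has_deriv jacobi_delta (fun p => - m * sin p * cos p / jacobi_delta p).
Proof.
have := has_deriv_sqrt jacobi_delta_arg_gt0 (has_derivB (has_deriv_cst 1)
  (has_derivZ m (has_derivX 2 (has_deriv_sin has_deriv_id)))).
move/has_deriv_eq; apply => p; have := jacobi_delta_gt0 p.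
rewrite /jacobi_delta /=; move: (Num.sqrt _) => d d0.
by field; rewrite gt_eqF.
Qed.

Lemma continuous_ellint : continuous (ellint k).
Proof.
have d0 p : jacobi_delta p != 0 by rewrite gt_eqF// jacobi_delta_gt0.
exact: has_deriv_continuous (has_derivV d0 has_deriv_jacobi_delta).
Qed.

Lemma ellFP : has_deriv (ellF k) (ellint k).
Proof. exact: has_deriv_oriented_integral continuous_ellint. Qed.

Lemma ellF0 : ellF k 0 = 0.
Proof. exact: oriented_integral0. Qed.

Lemma ellF_pihalf : ellF k (pi / 2) = ellK k.
Proof. by rewrite /ellF divr_ge0// pi_ge0. Qed.

Lemma ellint_gt0 (p : R) : 0 < ellint k p.
Proof. by rewrite invr_gt0; exact: jacobi_delta_gt0. Qed.

Lemma ellint_ge1 (p : R) : 1 <= ellint k p.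
Proof. by rewrite invf_ge1; [exact: jacobi_delta_le1|exact: jacobi_delta_gt0]. Qed.

Lemma ellF_lt (p q : R) : p < q -> ellF k p < ellF k q.
Proof. by apply: has_deriv_lt ellFP _ => x _; exact: ellint_gt0. Qed.

Lemma ellF_inj : injective (ellF k).
Proof.
by move=> p q; case: (ltgtP p q) => // /ellF_lt; [move/lt_eqF/eqP|move/gt_eqF/eqP].
Qed.

(** The integrand is at least 1; this makes [ellF k] surjective. *)
Lemma ellF_subr_ge (p q : R) : p <= q -> q - p <= ellF k q - ellF k p.
Proof.
move=> pq; have dG := has_derivB ellFP has_deriv_id.
suff : ellF k p - p <= ellF k q - q by lra.
by apply: (has_deriv_le dG) => // x _; rewrite subr_ge0 ellint_ge1.
Qed.

Lemma ellF_surj (u : R) : exists p, ellF k p = u.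
Proof.
pose a := `|u|; have a0 : 0 <= a by exact: normr_ge0.
have := ellF_subr_ge a0; have := @ellF_subr_ge (- a) 0.
rewrite ellF0 oppr_le0 => /(_ a0) h1 h2.
have ua : u <= a by exact: ler_norm.
have nua : - a <= u by rewrite lerNl /a -normrN ler_norm.
have [|||p _ pu] := @IVT R (ellF k) (- a) a u.
- by lra.
- exact: has_deriv_within ellFP.
- have ab : ellF k (- a) <= ellF k a by lra.
  by rewrite (min_idPl ab) (max_idPr ab); lra.
by exists p.
Qed.

Lemma jacobi_amK (u : R) : ellF k (jacobi_am k u) = u.
Proof. exact: (getPex (ellF_surj u)). Qed.

Lemma ellFK (p : R) : jacobi_am k (ellF k p) = p.
Proof. by apply: ellF_inj; rewrite jacobi_amK. Qed.

Lemma has_deriv_jacobi_am :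
  has_deriv (jacobi_am k) (fun u => jacobi_delta (jacobi_am k u)).
Proof.
move=> u; rewrite -{1}(jacobi_amK u) -[jacobi_delta _]invrK.
apply: (@is_derive_inverse _ (ellF k)).
- by near=> x; exact: ellFK.
- by near=> x; exact: (has_deriv_continuous ellFP).
- exact: ellFP.
- by rewrite gt_eqF// ellint_gt0.
Unshelve. all: by end_near. Qed.

Lemma ellK_gt0 : 0 < ellK k.
Proof. by rewrite -ellF_pihalf -ellF0; apply: ellF_lt; rewrite divr_gt0// pi_gt0. Qed.

Lemma ellF_pi_sub (p : R) : ellF k (pi - p) = ellK k *+ 2 - ellF k p.
Proof.
have dr : has_deriv (fun x => - ellF k (-1 * x + pi)) (ellint k).
  apply: has_deriv_eq (has_derivN (has_deriv_affine (-1) pi ellFP)) _ => x.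
  by rewrite !mulN1r opprK /ellint sinDpi sinN opprK.
have := has_deriv_unique dr ellFP p (pi / 2).
have -> : -1 * (pi / 2) + pi = pi / 2 :> R by field.
rewrite ellF_pihalf mulN1r [- p + _]addrC mulr2n => E.
by move: (ellF k (pi - p)) E => a E; lra.
Qed.

Lemma ellFDpi (p : R) : ellF k (p + pi) = ellF k p + ellK k *+ 2.
Proof.
have dr : has_deriv (fun x => ellF k (1 * x + pi)) (ellint k).
  apply: has_deriv_eq (has_deriv_affine 1 pi ellFP) _ => x.
  by rewrite !mul1r /ellint sinDpi sqrrN.
have := has_deriv_unique dr ellFP p 0.
have := ellF_pi_sub 0; rewrite !mul1r add0r subr0 ellF0 subr0 => -> E.
by move: (ellF k (p + pi)) E => a E; lra.
Qed.

Lemma jacobi_amD2K (u : R) : jacobi_am k (u + ellK k *+ 2) = jacobi_am k u + pi.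
Proof. by apply: ellF_inj; rewrite ellFDpi !jacobi_amK. Qed.

Definition jacobi_sn u : R := sin (jacobi_am k u).
Definition jacobi_dn u : R := jacobi_delta (jacobi_am k u).
Notation sn := jacobi_sn.
Notation cn := (fun u => jacobi_cn u k).
Notation dn := jacobi_dn.

Lemma has_deriv_sn : has_deriv sn (fun u => cn u * dn u).
Proof. exact: has_deriv_sin has_deriv_jacobi_am. Qed.

Lemma has_deriv_cn : has_deriv cn (fun u => - sn u * dn u).
Proof. exact: has_deriv_cos has_deriv_jacobi_am. Qed.

Lemma has_deriv_dn : has_deriv dn (fun u => - m * (sn u * cn u)).
Proof.
have := has_deriv_comp has_deriv_jacobi_delta has_deriv_jacobi_am.
move/has_deriv_eq; apply => u; rewrite divfK ?mulrA//.
by rewrite gt_eqF// jacobi_delta_gt0.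
Qed.

Lemma sn2cn2 u : sn u ^+ 2 = 1 - cn u ^+ 2.
Proof. exact: sin2cos2. Qed.

Lemma dn2cn2 u : dn u ^+ 2 = 1 - m + m * cn u ^+ 2.
Proof. by rewrite jacobi_delta_sqr -/(sn u) sn2cn2; ring. Qed.

Lemma cn2D2K u : cn (u + ellK k *+ 2) ^+ 2 = cn u ^+ 2.
Proof. by rewrite /jacobi_cn jacobi_amD2K cosDpi sqrrN. Qed.

End elliptic_functions.

Section period_monotonicity.
Context {R : realType}.

(** The square of either side is [2 * (v m ^+ 2 + v m)], where [v m] is the
    quotient of [1 - m / 2], the mean of the two radicands, by their geometric
    mean; and [v] increases with [m]. *)
Lemma reflected_sum_mono (m1 m2 s : R) : 0 <= m1 -> m1 <= m2 -> m2 < 1 ->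
  0 <= s <= 1 ->
  Num.sqrt (1 - m1 / 2) *
    ((Num.sqrt (1 - m1 * s))^-1 + (Num.sqrt (1 - m1 * (1 - s)))^-1) <=
  Num.sqrt (1 - m2 / 2) *
    ((Num.sqrt (1 - m2 * s))^-1 + (Num.sqrt (1 - m2 * (1 - s)))^-1).
Proof.
move=> m10 m12 m21 s01; have m20 := le_trans m10 m12; have m11 := le_lt_trans m12 m21.
pose v m := (1 - m / 2) / (Num.sqrt (1 - m * s) * Num.sqrt (1 - m * (1 - s))).
have pos m : 0 <= m -> m < 1 ->
    [/\ 0 < 1 - m / 2, 0 < 1 - m * s & 0 < 1 - m * (1 - s)].
  by move=> m0 mlt1; split; nra.
have v0 m : 0 <= m -> m < 1 -> 0 < v m.
  move=> m0 mlt1; have [h1 h2 h3] := pos m m0 mlt1.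
  by rewrite divr_gt0// mulr_gt0// sqrtr_gt0.
have sumE m : 0 <= m -> m < 1 -> (Num.sqrt (1 - m / 2) *
    ((Num.sqrt (1 - m * s))^-1 + (Num.sqrt (1 - m * (1 - s)))^-1)) ^+ 2 =
    2 * (v m ^+ 2 + v m).
  move=> m0 mlt1; have [h1 h2 h3] := pos m m0 mlt1; rewrite /v.
  have : 0 < Num.sqrt (1 - m * s) by rewrite sqrtr_gt0.
  have : 0 < Num.sqrt (1 - m * (1 - s)) by rewrite sqrtr_gt0.
  have := sqr_sqrtr (ltW h1); have := sqr_sqrtr (ltW h2).
  have := sqr_sqrtr (ltW h3).
  move: (Num.sqrt (1 - m / 2)) (Num.sqrt _) (Num.sqrt _) => A Y X EY EX EA Y0 X0.
  rewrite exprMn EA; have E : X ^+ 2 + Y ^+ 2 = 2 * (1 - m / 2).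
    by rewrite EX EY; field.
  have -> : 1 - m / 2 = (X ^+ 2 + Y ^+ 2) / 2 by rewrite E; field.
  by field; rewrite !gt_eqF.
rewrite -ler_sqr ?nnegrE ?mulr_ge0 ?addr_ge0 ?invr_ge0 ?sqrtr_ge0// !sumE//.
suff vle : v m1 <= v m2.
  rewrite ler_pM2l// lerD//.
  by rewrite ler_sqr// nnegrE ltW// v0.
have [a1 b1 c1] := pos m1 m10 m11; have [a2 b2 c2] := pos m2 m20 m21.
rewrite -ler_sqr ?nnegrE ?(ltW (v0 _ _ _))// /v !expr_div_n !exprMn.
rewrite !sqr_sqrtr ?(ltW b1, ltW c1, ltW b2, ltW c2)//.
rewrite ler_pdivrMr ?mulr_gt0// mulrAC ler_pdivlMr ?mulr_gt0//.
have q0 : 0 <= (s - 1 / 2) ^+ 2 by exact: sqr_ge0.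
have h : m1 * (1 - m2 / 2) <= m2 * (1 - m1 / 2) by lra.
have h2 : (m1 * (1 - m2 / 2)) ^+ 2 <= (m2 * (1 - m1 / 2)) ^+ 2.
  by rewrite ler_sqr// nnegrE mulr_ge0// ltW.
have := ler_wpM2l q0 h2.
by move=> E; rewrite -subr_ge0; rewrite -subr_ge0 in E; move: E; congr (0 <= _); field.
Qed.

(** Pairing each angle with its complement turns twice the integral into that of
    the sum in [reflected_sum_mono], with [s := sin p ^+ 2]. *)
Lemma ellK_scaled_mono (k1 k2 : R) : 0 < k1 < 1 -> 0 < k2 < 1 -> k1 <= k2 ->
  Num.sqrt (1 - k1 ^+ 2 / 2) * ellK k1 <= Num.sqrt (1 - k2 ^+ 2 / 2) * ellK k2.
Proof.
move=> k1i k2i k12.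
pose H (k p : R) := ellF k p - ellF k (-1 * p + pi / 2).
have dH k : 0 < k < 1 ->
    has_deriv (H k) (fun p => ellint k p + ellint k (pi / 2 - p)).
  move=> ki; have := has_derivB (ellFP ki) (has_deriv_affine (-1) (pi / 2) (ellFP ki)).
  move/has_deriv_eq; apply => p.
  by rewrite !mulN1r opprK [- p + _]addrC.
have dG := has_derivB (has_derivZ (Num.sqrt (1 - k2 ^+ 2 / 2)) (dH _ k2i))
  (has_derivZ (Num.sqrt (1 - k1 ^+ 2 / 2)) (dH _ k1i)).
have pi20 : 0 <= pi / 2 :> R by rewrite divr_ge0// pi_ge0.
have H0 k : 0 < k < 1 -> H k 0 = - ellK k.
  by move=> ki; rewrite /H mulr0 add0r ellF0 ellF_pihalf sub0r.
have H1 k : 0 < k < 1 -> H k (pi / 2) = ellK k.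
  by move=> ki; rewrite /H mulN1r addNr ellF0 ellF_pihalf subr0.
suff G0 p : 0 < p < pi / 2 -> 0 <=
    Num.sqrt (1 - k2 ^+ 2 / 2) * (ellint k2 p + ellint k2 (pi / 2 - p)) -
    Num.sqrt (1 - k1 ^+ 2 / 2) * (ellint k1 p + ellint k1 (pi / 2 - p)).
  by have := has_deriv_le dG G0 pi20; rewrite !H0// !H1//; lra.
move=> _; rewrite subr_ge0 /ellint.
rewrite [pi / 2 - p]addrC sinDpihalf cosN cos2sin2.
have /andP[m10 m11] := modulus_sqr_itv k1i.
have /andP[m20 m21] := modulus_sqr_itv k2i.
apply: reflected_sum_mono => //; first exact: ltW.
  by rewrite ler_sqr// nnegrE ltW//; [case/andP: k1i|case/andP: k2i].
rewrite sqr_ge0/= sin2cos2 gerBl; exact: sqr_ge0.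
Qed.

(** Scaling [ellK] as above leaves the factor
    [sqrt (m ^+ 2 - m + 1) / (1 - m / 2) = sqrt (1 + 3 / 4 * tau ^+ 2)] with
    [tau := m / (1 - m / 2)] increasing. *)
Lemma gK_lt (k1 k2 : R) : 0 < k1 < 1 -> 0 < k2 < 1 -> k1 < k2 -> gK k1 < gK k2.
Proof.
move=> k1i k2i k12.
have := ellK_scaled_mono k1i k2i (ltW k12).
have K1 := ellK_gt0 k1i; have K2 := ellK_gt0 k2i.
have /andP[m10 m11] := modulus_sqr_itv k1i.
have /andP[m20 m21] := modulus_sqr_itv k2i.
have m12 : k1 ^+ 2 < k2 ^+ 2.
  by rewrite ltr_sqr// nnegrE ltW//; [case/andP: k1i|case/andP: k2i].
rewrite /gK !(exprM _ 2 2); move: (k1 ^+ 2) (k2 ^+ 2) m10 m11 m20 m21 m12.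
move=> m1 m2 m10 m11 m20 m21 m12.
have A1 : 0 < 1 - m1 / 2 by lra.
have A2 : 0 < 1 - m2 / 2 by lra.
have D1 : 0 < m1 ^+ 2 - m1 + 1 by nra.
have D2 : 0 < m2 ^+ 2 - m2 + 1 by nra.
move=> KA; have {}KA : (1 - m1 / 2) * ellK k1 ^+ 2 <= (1 - m2 / 2) * ellK k2 ^+ 2.
  rewrite -(sqr_sqrtr (ltW A1)) -(sqr_sqrtr (ltW A2)) -!exprMn.
  by rewrite ler_sqr// nnegrE mulr_ge0 ?sqrtr_ge0 ?(ltW K1) ?(ltW K2).
rewrite -!mulrA ltr_pM2l//.
have d1 : 0 < Num.sqrt (m1 ^+ 2 - m1 + 1) by rewrite sqrtr_gt0.
have d2 : 0 < Num.sqrt (m2 ^+ 2 - m2 + 1) by rewrite sqrtr_gt0.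
have DA : Num.sqrt (m1 ^+ 2 - m1 + 1) * (1 - m2 / 2) <
    Num.sqrt (m2 ^+ 2 - m2 + 1) * (1 - m1 / 2).
  rewrite -ltr_sqr ?nnegrE ?mulr_ge0 ?(ltW d1) ?(ltW d2) ?(ltW A1) ?(ltW A2)//.
  rewrite !exprMn !sqr_sqrtr ?(ltW D1) ?(ltW D2)//.
  have h : m1 * (1 - m2 / 2) < m2 * (1 - m1 / 2) by lra.
  have : (m1 * (1 - m2 / 2)) ^+ 2 < (m2 * (1 - m1 / 2)) ^+ 2.
    by rewrite ltr_sqr// nnegrE mulr_ge0// ltW.
  move=> E; rewrite -subr_gt0; rewrite -subr_gt0 in E.
  have {}E : 0 < 3 / 4 * ((m2 * (1 - m1 / 2)) ^+ 2 - (m1 * (1 - m2 / 2)) ^+ 2).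
    by rewrite mulr_gt0// divr_gt0.
  by move: E; congr (0 < _); field.
have K12 : 0 < ellK k1 ^+ 2 by rewrite exprn_gt0.
rewrite -(ltr_pM2r (mulr_gt0 A1 A2)).
apply: (@lt_le_trans _ _ ((1 - m1 / 2) * ellK k1 ^+ 2 *
    (Num.sqrt (m2 ^+ 2 - m2 + 1) * (1 - m1 / 2)))).
  by have := DA; rewrite -(ltr_pM2l (mulr_gt0 A1 K12)); congr (_ < _); ring.
by have := ler_wpM2r (ltW (mulr_gt0 d2 A1)) KA; congr (_ <= _); ring.
Qed.

End period_monotonicity.

(** * The cnoidal profile *)

Section cnoidal_profile.
Context {R : realType}.
Variables (L k : R).
Hypotheses (L0 : 0 < L) (k01 : 0 < k < 1) (mt0 : 0 < mtilde L k).
Implicit Types f g eta : R -> R.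
Notation mu := (@lebesgue_measure R).
Notation m := (k ^+ 2).
Notation K := (ellK k).

Definition disc : R := Num.sqrt (k ^+ 4 - m + 1).

Let wavenumber : R := 2 * K / L.

Definition cn2_wave x : R := jacobi_cn (2 * K / L * x) k ^+ 2.

(** The square root of [phi] divided by [amplitude], normalized so that the
    equation [w'' = rate * (12 * w - 6 * w ^+ 2)] depends on [k] only through
    [rate]. *)
Definition profile x : R := (disc + 1 - 2 * m + 3 * m * cn2_wave x) / disc.

Definition profile' x : R := - 6 * m * wavenumber / disc *
  (jacobi_sn k (wavenumber * x) * jacobi_cn (wavenumber * x) k
   * jacobi_dn k (wavenumber * x)).

Definition rate : R := wavenumber ^+ 2 * disc / 3.

Definition crest : R := (disc + 1 + m) / disc.

(** The constant in the first integral of the profile equation, read off at the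
    crest, where the derivative of the profile vanishes. *)
Definition first_integral : R := crest ^+ 2 * (3 - crest).

Definition amplitude : R := 80 * K ^+ 2 / (3 * mtilde L k) * disc.

Lemma disc_sqr : disc ^+ 2 = m ^+ 2 - m + 1.
Proof.
have /andP[m0 m1] := modulus_sqr_itv k01.
by rewrite sqr_sqrtr (exprM _ 2 2)//; nra.
Qed.

Lemma disc_gt0 : 0 < disc.
Proof.
have /andP[m0 m1] := modulus_sqr_itv k01.
by rewrite sqrtr_gt0 (exprM _ 2 2); nra.
Qed.

Lemma rate_gt0 : 0 < rate.
Proof.
have K0 := ellK_gt0 k01.
by rewrite divr_gt0// mulr_gt0 ?disc_gt0// exprn_gt0// divr_gt0// mulr_gt0.
Qed.

Lemma first_integral_gt0 : 0 < first_integral.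
Proof.
have /andP[m0 m1] := modulus_sqr_itv k01; have D0 := disc_gt0.
have E : crest * disc = disc + 1 + m by rewrite divfK// gt_eqF.
apply: mulr_gt0; first by rewrite exprn_gt0// divr_gt0//; lra.
rewrite subr_gt0 -(ltr_pM2r D0) E.
suff : 1 + m < 2 * disc by lra.
rewrite -ltr_sqr ?nnegrE; [|lra..].
by rewrite exprMn disc_sqr; nra.
Qed.

(** [4 - gam = (crest - 2) ^+ 2 * (crest + 1)] for [gam := first_integral]. *)
Lemma first_integral_lt4 : first_integral < 4.
Proof.
have /andP[m0 m1] := modulus_sqr_itv k01; have D0 := disc_gt0.
have E : crest * disc = disc + 1 + m by rewrite divfK// gt_eqF.
have c1 : 0 < crest by rewrite divr_gt0//; lra.
have c2 : crest != 2.
  apply/eqP => c2; move: E; rewrite c2 => E.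
  have : disc ^+ 2 = (1 + m) ^+ 2 by congr (_ ^+ 2); lra.
  by rewrite disc_sqr => ?; nra.
rewrite -subr_gt0 (_ : _ - _ = (crest - 2) ^+ 2 * (crest + 1)).
  by rewrite mulr_gt0 ?addr_gt0// exprn_even_gt0//= subr_eq0.
by rewrite /first_integral; ring.
Qed.

Lemma cn2_wave_periodic : periodic cn2_wave L.
Proof.
move=> x; rewrite /cn2_wave -[RHS](cn2D2K k01); congr (jacobi_cn _ _ ^+ _).
by field; rewrite gt_eqF.
Qed.

Lemma profile_gt0 x : 0 < profile x.
Proof.
have /andP[m0 m1] := modulus_sqr_itv k01.
have y0 : 0 <= 3 * m * cn2_wave x.
  by apply: mulr_ge0; [apply: mulr_ge0 => //; exact: ltW|exact: sqr_ge0].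
rewrite divr_gt0 ?disc_gt0//; suff : 0 < disc + 1 - 2 * m by lra.
have [h|h] := ltP (2 * m - 1) 0; first by have := disc_gt0; lra.
suff : 2 * m - 1 < disc by lra.
rewrite -ltr_sqr ?nnegrE//; last exact/ltW/disc_gt0.
by rewrite disc_sqr; nra.
Qed.

Lemma has_deriv_wave f f' : has_deriv f f' ->
  has_deriv (fun x => f (wavenumber * x))
            (fun x => wavenumber * f' (wavenumber * x)).
Proof.
move=> df; have := has_deriv_affine wavenumber 0 df.
rewrite (_ : (fun x => f (_ + 0)) = fun x => f (wavenumber * x)); last first.
  by apply/funext => x; rewrite addr0.
by move/has_deriv_eq; apply => x; rewrite addr0.
Qed.

Lemma has_deriv_profile : has_deriv profile profile'.
Proof.
have := has_derivZ disc^-1 (has_derivD (has_deriv_cst (disc + 1 - 2 * m))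
  (has_derivZ (3 * m) (has_derivX 2 (has_deriv_wave (has_deriv_cn k01))))).
rewrite (_ : (fun x => disc^-1 * _) = profile).
  by move/has_deriv_eq; apply => x; rewrite /profile' /=; ring.
by apply/funext => x; rewrite mulrC.
Qed.

Lemma has_deriv_profile' :
  has_deriv profile' (fun x => rate * (12 * profile x - 6 * profile x ^+ 2)).
Proof.
have dc := has_deriv_wave (has_deriv_cn k01).
have ds := has_deriv_wave (has_deriv_sn k01).
have dd := has_deriv_wave (has_deriv_dn k01).
have := has_derivZ (- 6 * m * wavenumber / disc)
  (has_derivM (has_derivM ds dc) dd).
move/has_deriv_eq; apply => x.
rewrite /rate /profile /cn2_wave -/wavenumber.
have := sn2cn2 k (wavenumber * x); have := dn2cn2 k01 (wavenumber * x).
move: (jacobi_sn k _) (jacobi_cn _ k) (jacobi_dn k _) => s c d ed es.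
have D0 : disc != 0 by rewrite gt_eqF// disc_gt0.
have -> : wavenumber ^+ 2 * disc / 3 *
    (12 * ((disc + 1 - 2 * m + 3 * m * c ^+ 2) / disc)
     - 6 * ((disc + 1 - 2 * m + 3 * m * c ^+ 2) / disc) ^+ 2) =
    2 * wavenumber ^+ 2 / disc *
    (disc ^+ 2 - (1 - 2 * m + 3 * m * c ^+ 2) ^+ 2) by field.
rewrite disc_sqr.
transitivity (- 6 * m * wavenumber ^+ 2 / disc *
    (c ^+ 2 * d ^+ 2 - s ^+ 2 * d ^+ 2 - m * (s ^+ 2 * c ^+ 2))).
  by ring.
by rewrite ed es; ring.
Qed.

Lemma profile'_sqr x : profile' x ^+ 2 =
  - 4 * rate * (profile x ^+ 3 - 3 * profile x ^+ 2 + first_integral).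
Proof.
rewrite /rate /profile' /first_integral /crest /profile /cn2_wave -/wavenumber.
have := sn2cn2 k (wavenumber * x); have := dn2cn2 k01 (wavenumber * x).
move: (jacobi_sn k _) (jacobi_cn _ k) (jacobi_dn k _) => s c d ed es.
have D0 : disc != 0 by rewrite gt_eqF// disc_gt0.
transitivity (4 / 3 * wavenumber ^+ 2 / disc ^+ 2 *
    (27 * m ^+ 2 * (c ^+ 2 * (1 - c ^+ 2) * (1 - m + m * c ^+ 2)))).
  by rewrite -ed -es; field.
have -> : 27 * m ^+ 2 * (c ^+ 2 * (1 - c ^+ 2) * (1 - m + m * c ^+ 2)) =
   - ((disc + 1 - 2 * m + 3 * m * c ^+ 2) ^+ 3
      - 3 * disc * (disc + 1 - 2 * m + 3 * m * c ^+ 2) ^+ 2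
      + (disc + 1 + m) ^+ 2 * (2 * disc - 1 - m)).
  have := disc_sqr; move: disc (k ^+ 2) => D n E.
  by ring: E.
by field.
Qed.

Lemma smooth_per_profile : smooth_per L profile.
Proof.
apply/smooth_perP; split.
  by move=> x; rewrite /profile cn2_wave_periodic.
suff H n : smooth_upto n profile /\ smooth_upto n profile'.
  by move=> n; case: (H n).
elim: n => [//|n [IH IH']]; split.
  by exists profile'; first exact: has_deriv_profile.
exists (fun x => rate * (12 * profile x - 6 * profile x ^+ 2)).
  exact: has_deriv_profile'.
rewrite (_ : (fun x => _) = fun x =>
  12 * rate * profile x + - 6 * rate * (profile x * profile x)).
  apply: smooth_uptoD; apply: smooth_uptoM; try exact: smooth_upto_cst.
    exact: IH.
  exact: smooth_uptoM.
by apply/funext => x; ring.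
Qed.

Lemma amplitude_gt0 : 0 < amplitude.
Proof.
by rewrite mulr_gt0 ?disc_gt0// divr_gt0// mulr_gt0// exprn_gt0// ellK_gt0.
Qed.

Lemma phiE : phi L k = fun x => (amplitude * profile x) ^+ 2.
Proof.
apply/funext => x; rewrite /phi /amplitude /profile /cn2_wave; congr (_ ^+ 2).
have mtE : L ^+ 2 = mtilde L k + 64 * K ^+ 2 * disc.
  by rewrite /mtilde /disc subrK.
move: (jacobi_cn _ k) => c; rewrite [in LHS]mtE.
have D0 := disc_gt0; move: (disc) (mtilde L k) mt0 D0 => D mt mt1 D0.
by field; rewrite !gt_eqF.
Qed.

Lemma sqrt_phi x : Num.sqrt (phi L k x) = amplitude * profile x.
Proof.
by rewrite phiE sqrtr_sqr ger0_norm// mulr_ge0// ltW ?amplitude_gt0 ?profile_gt0.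
Qed.

Lemma derive1_phi :
  derive1 (phi L k) = fun x => 2 * amplitude ^+ 2 * periodic_sol profile profile' x.
Proof.
rewrite phiE; apply: has_derivE.
have := has_derivX 2 (has_derivZ amplitude has_deriv_profile).
by move/has_deriv_eq; apply => x; rewrite /periodic_sol /=; ring.
Qed.

(** The coefficients match because [cspeed L k - 1] equals
    [64 * K ^+ 2 * disc / mtilde L k], that is [48 * rate * cspeed L k]. *)
Lemma linearized_opE (u u2 x : R) :
  - cspeed L k * u2 + (cspeed L k - 1) * u - 3 / 2 * Num.sqrt (phi L k x) * u =
  - cspeed L k * (u2 + potential rate profile x * u).
Proof.
have -> : cspeed L k - 1 = 64 * K ^+ 2 * disc / mtilde L k.
  rewrite /cspeed -[X in _ - X](divff (lt0r_neq0 mt0)) -mulrBl.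
  by rewrite {1}/mtilde opprB addrC subrK.
rewrite sqrt_phi /potential /rate /amplitude /cspeed /wavenumber.
by field; rewrite !gt_eqF.
Qed.

End cnoidal_profile.

(** * The kernel of the linearized operator *)

Section kernel_of_linearized_operator.
Context {R : realType}.
Variables (L k : R).
Hypotheses (L0 : 0 < L) (k01 : 0 < k < 1) (mt0 : 0 < mtilde L k).
Implicit Types f g h eta : R -> R.
Notation mu := (@lebesgue_measure R).
Notation w := (profile L k).
Notation V := (potential (rate L k) w).
Notation v := (periodic_sol w (profile' L k)).
Notation v' := (periodic_sol' (rate L k) (first_integral k) w).

Let dw := has_deriv_profile L k01.
Let dw1 := has_deriv_profile' L k01.
Let w_per := smooth_per_profile L0 k01.

Lemma has_deriv_v : has_deriv v v'.
Proof. exact: periodic_solP dw dw1 (profile'_sqr L k01). Qed.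

Lemma has_deriv_v' : has_deriv v' (fun x => - V x * v x).
Proof. exact: periodic_sol'P. Qed.

Lemma smooth_per_v : smooth_per L v.
Proof. exact: smooth_per_periodic_sol w_per dw. Qed.

Lemma norm_v_gt0 : 0 < \int[mu]_(x in `[0, L]) (v x * v x).
Proof.
exact: norm_periodic_sol_gt0 L0 (rate_gt0 L0 k01) (first_integral_gt0 k01)
  (first_integral_lt4 k01) dw dw1 (profile'_sqr L k01).
Qed.

Lemma cspeed_gt0 : 0 < cspeed L k.
Proof. by rewrite divr_gt0// exprn_gt0. Qed.

Lemma continuous_potential : continuous V.
Proof.
apply: (has_deriv_continuous (f' := fun x => rate L k * (30 * profile' L k x))).
have := has_derivZ (rate L k) (has_derivB (has_derivZ 30 dw) (has_deriv_cst 48)).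
by move/has_deriv_eq; apply => x; rewrite subr0.
Qed.

Lemma smooth_per_weak_derivative f f' : smooth_per L f -> has_deriv f f' ->
  weak_derivative L f f'.
Proof.
move=> fs df eta es; have de := smooth_per_has_deriv es.
have cf := smooth_per_continuous fs; have ce := smooth_per_continuous es.
have cf' := smooth_per_continuous (smooth_per_deriv df fs).
have ce' := smooth_per_continuous (smooth_per_deriv de es).
have i1 := integrable_mul_continuous (continuous_integrable_itv 0 L cf) ce'.
have i2 := integrable_mul_continuous (continuous_integrable_itv 0 L cf') ce.
have dM := has_derivM df de.
have cM := smooth_per_continuous (smooth_per_deriv dM (smooth_perM fs es)).
have := has_deriv_ftc dM cM (ltW L0).
have per g : smooth_per L g -> g L = g 0 by case=> pg _; rewrite -[RHS]pg add0r.
rewrite (per _ fs) (per _ es) subrr RintegralD// => /eqP.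
by rewrite addrC addr_eq0 => /eqP.
Qed.

(** Symmetry of the operator, with all derivatives moved to the test function,
    so that [f] enters only through its integrals. *)
Lemma linearized_op_weak f h : linearized_op L k f h ->
  [/\ mu.-integrable `[0, L] (EFin \o f), mu.-integrable `[0, L] (EFin \o h) &
  forall eta eta' eta'', smooth_per L eta -> has_deriv eta eta' ->
    has_deriv eta' eta'' ->
    \int[mu]_(x in `[0, L]) (h x * eta x) = - cspeed L k *
      \int[mu]_(x in `[0, L]) (f x * (eta'' x + V x * eta x))].
Proof.
move=> [h2 [f1 [f2 [[fL2 f1L2 f2L2 wf wf1] hE]]]].
have intf := L2per_integrable fL2; have intf2 := L2per_integrable f2L2.
have inth := L2per_integrable h2.
split=> // eta eta' eta'' es de de'.
have es' := smooth_per_deriv de es.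
have ce := smooth_per_continuous es.
have ce'' := smooth_per_continuous (smooth_per_deriv de' es').
have cV := continuous_potential.
have intVf := integrable_mul_continuous intf cV.
pose h0 x := - cspeed L k * f2 x + - cspeed L k * (f x * V x).
have h0E : (fun x => - cspeed L k * f2 x + (cspeed L k - 1) * f x
    - 3 / 2 * Num.sqrt (phi L k x) * f x) = h0.
  by apply/funext => x; rewrite linearized_opE// /h0; ring.
have inth0 : mu.-integrable `[0, L] (EFin \o h0).
  have Z g : mu.-integrable `[0, L] (EFin \o g) ->
      mu.-integrable `[0, L] (EFin \o (fun x => - cspeed L k * g x)).
    move=> ig; have := integrableZl _ (- cspeed L k) ig.
    move=> /(_ (measurable_itv _)).
    by congr integrable; apply/funext => x.
  have := integrableD _ (Z _ intf2) (Z _ intVf); move=> /(_ (measurable_itv _)).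
  by congr integrable; apply/funext => x.
rewrite h0E in hE.
rewrite (ae_eq_Rintegral hE inth inth0 ce).
have ie2 := integrable_mul_continuous intf2 ce.
have ieV := integrable_mul_continuous intVf ce.
have ie'' := integrable_mul_continuous intf ce''.
transitivity (\int[mu]_(x in `[0, L])
    (- cspeed L k * (f2 x * eta x) + - cspeed L k * (f x * V x * eta x))).
  by apply: eq_Rintegral => x _; rewrite /h0; ring.
have f2E : \int[mu]_(x in `[0, L]) (f2 x * eta x) =
    \int[mu]_(x in `[0, L]) (f x * eta'' x).
  have := wf1 _ es; have := wf _ es'.
  rewrite (has_derivE de) (has_derivE de') => -> ->.
  by rewrite opprK.
rewrite Rintegral_lin// f2E -mulrDr; congr (_ * _).
transitivity (\int[mu]_(x in `[0, L])
    (1 * (f x * eta'' x) + 1 * (f x * V x * eta x))).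
  by rewrite Rintegral_lin// !mul1r.
by apply: eq_Rintegral => x _; ring.
Qed.

Lemma linearized_op_kernel f h : linearized_op L k f h -> ae_eqL L h (cst 0) ->
  exists a, ae_eqL L f (fun x => a * v x).
Proof.
move=> Afh h0; have [intf inth weak] := linearized_op_weak Afh.
have c0 := cspeed_gt0.
apply: (weak_kernel_line L0 (rate_gt0 L0 k01) (first_integral_gt0 k01)
  (first_integral_lt4 k01) w_per (profile_gt0 L k01) dw dw1 (profile'_sqr L k01) intf).
move=> eta eta' eta'' es de de'.
have int0 : mu.-integrable `[0, L] (EFin \o (cst 0 : R -> R)).
  exact: continuous_integrable_itv (@cst_continuous _ _ (0 : R)).
have := weak _ _ _ es de de'.
rewrite (ae_eq_Rintegral h0 inth int0 (smooth_per_continuous es)).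
have -> : \int[mu]_(x in `[0, L]) ((cst 0 : R -> R) x * eta x) = 0.
  transitivity (\int[mu]_(x in `[0, L]) (0 * v x + 0 * v x)).
    by apply: eq_Rintegral => x _; rewrite !mul0r addr0.
  have iv := continuous_integrable_itv 0 L (smooth_per_continuous smooth_per_v).
  by rewrite Rintegral_lin// !mul0r addr0.
by move/esym/eqP; rewrite mulf_eq0 oppr_eq0 gt_eqF//= => /eqP.
Qed.

(** By symmetry the range is orthogonal to the kernel, so there is no Jordan
    chain above the eigenfunction. *)
Lemma linearized_op_range f h a : linearized_op L k f h ->
  ae_eqL L h (fun x => a * v x) -> a = 0.
Proof.
move=> Afh hE; have [intf inth weak] := linearized_op_weak Afh.
have cv := smooth_per_continuous smooth_per_v.
have iv := continuous_integrable_itv 0 L cv.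
have ivv := integrable_mul_continuous iv cv.
have cav : continuous (fun x => a * v x).
  exact: has_deriv_continuous (has_derivZ a has_deriv_v).
have := weak _ _ _ smooth_per_v has_deriv_v has_deriv_v'.
rewrite (ae_eq_Rintegral hE inth (continuous_integrable_itv 0 L cav) cv).
have -> : \int[mu]_(x in `[0, L]) (a * v x * v x) =
    a * \int[mu]_(x in `[0, L]) (v x * v x).
  transitivity (\int[mu]_(x in `[0, L]) (a * (v x * v x) + 0 * (v x * v x))).
    by apply: eq_Rintegral => x _; ring.
  by rewrite Rintegral_lin// mul0r addr0.
have -> : \int[mu]_(x in `[0, L]) (f x * (- V x * v x + V x * v x)) = 0.
  transitivity (\int[mu]_(x in `[0, L]) (0 * v x + 0 * v x)).
    by apply: eq_Rintegral => x _; ring.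
  by rewrite Rintegral_lin// !mul0r addr0.
by rewrite mulr0 => /eqP; rewrite mulf_eq0 (gt_eqF norm_v_gt0) orbF => /eqP.
Qed.

Lemma ker_pow_line n f : ker_pow L (linearized_op L k) 0 n f ->
  exists a, ae_eqL L f (fun x => a * v x).
Proof.
elim: n f => [|n IH] f /=.
  move=> [_ f0]; exists 0; rewrite (_ : (fun x => 0 * v x) = cst 0)//.
  by apply/funext => x; rewrite mul0r.
move=> [h [Afh]]; rewrite (_ : (fun x => h x - 0 * f x) = h); last first.
  by apply/funext => x; rewrite mul0r subr0.
move=> /IH[a hE]; apply: (linearized_op_kernel Afh).
rewrite (_ : cst 0 = fun x => a * v x)//.
by apply/funext => x; rewrite (linearized_op_range Afh hE) mul0r.
Qed.

Lemma linearized_op_line a : linearized_op L k (fun x => a * v x) (fun=> 0).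
Proof.
have dav := has_derivZ a has_deriv_v; have dav' := has_derivZ a has_deriv_v'.
have avs := smooth_perZ a smooth_per_v.
have avs' := smooth_per_deriv dav avs.
have avs'' := smooth_per_deriv dav' avs'.
have L2 f : smooth_per L f -> L2per L f.
  by move=> fs; apply: L2per_continuous (smooth_per_continuous fs); case: fs.
split; first exact: L2 (smooth_per_cst L 0).
exists (fun x => a * v' x), (fun x => a * (- V x * v x)); split.
  by split; do ?exact: L2; exact: smooth_per_weak_derivative.
apply: aeW => x _; rewrite linearized_opE//.
by rewrite (_ : a * _ + _ = 0) ?mulr0//; ring.
Qed.

Lemma line_not_ae0 a : a != 0 -> ~ ae_eqL L (fun x => a * v x) (cst 0).
Proof.
move=> a0 av0.
apply/negP: a0; apply/negPn/eqP; apply: (linearized_op_range (linearized_op_line 0)).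
apply: (filterS _ av0); first exact: (ae_filter_ringOfSetsType mu).
by move=> x /= E /E ->.
Qed.

End kernel_of_linearized_operator.

Theorem mainTheorem4 (R : realType) (L kL : R)
    (hL : 4 * pi < L)
    (hkL : 0 < kL < 1) (hgkL : gK kL = L ^+ 2)
    (k : R) (hk : 0 < k < kL) :
  simple_eigenvalue_with L (linearized_op L k) 0 (derive1 (phi L k)).
Proof.
have L0 : 0 < L by apply: lt_trans hL; rewrite mulr_gt0// pi_gt0.
have k01 : 0 < k < 1.
  by case/andP: hk => -> kkL; case/andP: hkL => _; exact: lt_trans.
have mt0 : 0 < mtilde L k.
  by rewrite subr_gt0 -hgkL; apply: gK_lt => //; case/andP: hk.
rewrite derive1_phi//.
have C0 : 2 * amplitude L k ^+ 2 != 0.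
  by rewrite mulf_neq0// expf_neq0// gt_eqF// amplitude_gt0.
split; first split.
- exact: line_not_ae0.
- rewrite (_ : (fun x => 0 * _) = fun=> 0); first exact: linearized_op_line.
  by apply/funext => x; rewrite mul0r.
move=> n f /(ker_pow_line L0 k01 mt0)[a fE].
exists (a / (2 * amplitude L k ^+ 2)).
rewrite (_ : (fun x => _) = fun x => a * periodic_sol (profile L k) (profile' L k) x)//.
by apply/funext => x; rewrite mulrA divfK.
Qed.
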